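(* Assume the Minimum-Witness Product hypothesis. Then any algorithm computing incremental {\rm SSBP}, and likewise decremental {\rm SSBP}, on $n$-node directed graphs requires $n^{2.5-o(1)}$ total update time over $n$ updates; equivalently, $n^{1.5-o(1)}$ amortized update time over $n$ updates.
   Context: {\rm SSBP}: for a directed edge-weighted graph and fixed source $s$, maintain for every node $v$ the maximum over $s$–$v$ paths of the minimum edge weight on the path. Incremental: only edge insertions; decremental: only edge deletions. Minimum-Witness Product: given $n\times n$ Boolean matrices $A,B$, compute for all $i,j$ the value $\min\{k: A_{ik}\wedge B_{kj}\}$. Minimum-Witness Product hypothesis: no $O(n^{2.5-\varepsilon})$-time algorithm computes it, for any $\varepsilon>0$. *)

(* Defs.v *)
From Stdlib Require Import Reals Arith List.
Import ListNotations.

(* A unit-cost word RAM, presented as a structured language over finitely many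
   scalar registers and finitely many arrays of words.  Interleaving the arrays
   in one memory, or compiling to jumps (and back), changes running times by
   constant factors only. *)

Record state := State { reg : nat -> nat; arr : nat -> nat -> nat }.

Definition upd {X : Type} (f : nat -> X) (a : nat) (x : X) : nat -> X :=
  fun b => if b =? a then x else f b.

Definition set_reg (x v : nat) (st : state) : state :=
  State (upd (reg st) x v) (arr st).

Definition set_cell (a p v : nat) (st : state) : state :=
  State (reg st) (upd (arr st) a (upd (arr st a) p v)).

Inductive binop :=
  Add | Sub | Mul | Div | Mod | And | Or | Xor | Shl | Shr | Ltb | Eqb.

(* Sub is truncated at 0; x / 0 = 0 and x mod 0 = x. *)
Definition eval_binop (o : binop) (x y : nat) : nat :=
  match o with
  | Add => x + y
  | Sub => x - y
  | Mul => x * y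
  | Div => x / y
  | Mod => x mod y
  | And => Nat.land x y
  | Or => Nat.lor x y
  | Xor => Nat.lxor x y
  | Shl => Nat.shiftl x y
  | Shr => Nat.shiftr x y
  | Ltb => Nat.b2n (x <? y)
  | Eqb => Nat.b2n (x =? y)
  end.

Inductive rhs :=
| Const (k : nat)
| Binop (o : binop) (y z : nat)
| Fetch (a y : nat).

Definition eval_rhs (st : state) (e : rhs) : nat :=
  match e with
  | Const k => k
  | Binop o y z => eval_binop o (reg st y) (reg st z)
  | Fetch a y => arr st a (reg st y)
  end.

Inductive cmd :=
| Skip
| Assign (x : nat) (e : rhs)
| Store (a y z : nat)
| Seq (c1 c2 : cmd)
| If (x : nat) (c1 c2 : cmd)
| While (x : nat) (c : cmd).

(* [exec w c st st' t]: with words of w bits, c started in st halts in st' after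
   exactly t steps.  A run in which an operation overflows the word has no
   derivation, so that an algorithm must choose its (logarithmic) word length
   large enough; wrap-around arithmetic on w bits can be simulated in 2 w bits
   with constant overhead, so this loses no generality. *)
Inductive exec (w : nat) : cmd -> state -> state -> nat -> Prop :=
| exec_skip st : exec w Skip st st 1
| exec_assign x e st :
    eval_rhs st e < 2 ^ w ->
    exec w (Assign x e) st (set_reg x (eval_rhs st e) st) 1
| exec_store a y z st :
    exec w (Store a y z) st (set_cell a (reg st y) (reg st z) st) 1
| exec_seq c1 c2 st st1 st2 t1 t2 :
    exec w c1 st st1 t1 -> exec w c2 st1 st2 t2 ->
    exec w (Seq c1 c2) st st2 (t1 + t2)
| exec_if_true x c1 c2 st st' t :
    reg st x <> 0 -> exec w c1 st st' t -> exec w (If x c1 c2) st st' (S t)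
| exec_if_false x c1 c2 st st' t :
    reg st x = 0 -> exec w c2 st st' t -> exec w (If x c1 c2) st st' (S t)
| exec_while_true x c st st1 st2 t1 t2 :
    reg st x <> 0 -> exec w c st st1 t1 -> exec w (While x c) st1 st2 t2 ->
    exec w (While x c) st st2 (S (t1 + t2))
| exec_while_false x c st :
    reg st x = 0 -> exec w (While x c) st st 1.

(* Words of c (floor(log2 n) + 1) bits: the usual O(log n)-bit words. *)
Definition word_length (c n : nat) : nat := c * S (Nat.log2 n).

Definition blank : state := State (fun _ => 0) (fun _ _ => 0).

Definition set_array (a : nat) (f : nat -> nat) (st : state) : state :=
  State (reg st) (upd (arr st) a f).

(* n x n matrices are functions of two indices, only indices < n mattering. *)
Definition row_major (n : nat) (f : nat -> nat -> nat) : nat -> nat :=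
  fun p => if p <? n * n then f (p / n) (p mod n) else 0.

Definition encode (o : option nat) : nat :=
  match o with None => 0 | Some x => S x end.

Definition is_least (P : nat -> Prop) (o : option nat) : Prop :=
  match o with
  | Some m => P m /\ forall x, P x -> m <= x
  | None => forall x, ~ P x
  end.

Definition is_greatest (P : nat -> Prop) (o : option nat) : Prop :=
  match o with
  | Some m => P m /\ forall x, P x -> x <= m
  | None => forall x, ~ P x
  end.

Definition bigO (f g : nat -> R) : Prop :=
  exists (C : R) (N : nat), forall n : nat,
    N <= n -> (Rabs (f n) <= C * g n)%R.

Definition witness (n : nat) (A B : nat -> nat -> bool) (i j k : nat) : Prop :=
  k < n /\ A i k = true /\ B k j = true.

(* Minimum-Witness Product (mwp): register 0 holds n, arrays 0 and 1 hold A and B; the product is to be left in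
   array 2, an entry with no witness being [encode None]. *)
Definition mwp_input (n : nat) (A B : nat -> nat -> bool) : state :=
  set_reg 0 n
    (set_array 0 (row_major n (fun i k => Nat.b2n (A i k)))
      (set_array 1 (row_major n (fun k j => Nat.b2n (B k j))) blank)).

Definition mwp_output (n : nat) (A B : nat -> nat -> bool) (st : state) : Prop :=
  forall i j, i < n -> j < n ->
    exists o, is_least (witness n A B i j) o /\ arr st 2 (i * n + j) = encode o.

Definition computes_mwp (P : cmd) (T : nat -> nat) : Prop :=
  exists c, forall (n : nat) (A B : nat -> nat -> bool),
    exists st t, exec (word_length c n) P (mwp_input n A B) st t /\
      mwp_output n A B st /\ t <= T n.

Definition mwp_time (P : cmd) (f : nat -> R) : Prop :=
  exists T, computes_mwp P T /\ bigO (fun n => INR (T n)) f.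

Definition mwp_hypothesis : Prop :=
  forall eps : R, (0 < eps)%R ->
    ~ exists P : cmd, mwp_time P (fun n => Rpower (INR n) (5 / 2 - eps)).

Definition graph := nat -> nat -> option nat.

(* Simple directed graphs on {0, ..., n-1} with edge weights in {0, ..., W}. *)
Definition is_graph (n W : nat) (G : graph) : Prop :=
  forall u v w, G u v = Some w -> u < n /\ v < n /\ u <> v /\ w <= W.

(* [walk G u p v ws]: u :: p lists the nodes, and ws the edge weights, of a walk
   from u to v. *)
Inductive walk (G : graph) : nat -> list nat -> nat -> list nat -> Prop :=
| walk_nil u : walk G u [] u []
| walk_cons u x p v w ws :
    G u x = Some w -> walk G x p v ws -> walk G u (x :: p) v (w :: ws).

Definition path_width (G : graph) (s v b : nat) : Prop :=
  exists p ws, walk G s p v ws /\ NoDup (s :: p) /\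
    In b ws /\ Forall (fun w => b <= w) ws.

Definition bottleneck (G : graph) (s v : nat) (o : option nat) : Prop :=
  is_greatest (path_width G s v) o.

(* An edge update (u, v, x) replaces the entry G u v by x. *)
Definition update := (nat * nat * option nat)%type.

Definition apply (G : graph) (e : update) : graph :=
  let '(u, v, x) := e in upd G u (upd (G u) v x).

Inductive mode := Incremental | Decremental.

Definition legal (m : mode) (n W : nat) (G : graph) (e : update) : Prop :=
  let '(u, v, x) := e in
  u < n /\ v < n /\ u <> v /\
  match m with
  | Incremental => G u v = None /\ exists w, w <= W /\ x = Some w
  | Decremental => G u v <> None /\ x = None
  end.

Fixpoint legal_sequence (m : mode) (n W : nat) (G : graph) (es : list update)
  : Prop :=
  match es with
  | [] => True
  | e :: es' => legal m n W G e /\ legal_sequence m n W (apply G e) es'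
  end.

(* A dynamic algorithm: [setup] is run once on the initial graph, then [react] is
   run on each update in turn, all memory persisting between the runs. *)
Record dynamic_algorithm := Dynamic { setup : cmd; react : cmd }.

(* Single-source bottleneck paths (ssbp): registers 0 and 1 hold n and the source,
   array 0 the initial adjacency matrix. *)
Definition ssbp_input (n s : nat) (G : graph) : state :=
  set_reg 0 n (set_reg 1 s
    (set_array 0 (row_major n (fun u v => encode (G u v))) blank)).

(* Each update is written to registers 2, 3 and 4. *)
Definition feed (e : update) (st : state) : state :=
  let '(u, v, x) := e in set_reg 2 u (set_reg 3 v (set_reg 4 (encode x) st)).

(* Cell v of array 1 must hold the value of v ([encode None] if v is unreachable).
   The value of the source itself is infinity by convention and is not asked for. *)
Definition ssbp_output (n s : nat) (G : graph) (st : state) : Prop :=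
  forall v, v < n -> v <> s ->
    exists o, bottleneck G s v o /\ arr st 1 v = encode o.

(* [serves w c n s G st es t]: from memory st, current graph G, the updates es are
   processed online in t steps overall, all values being correct at every stage. *)
Inductive serves (w : nat) (c : cmd) (n s : nat)
  : graph -> state -> list update -> nat -> Prop :=
| serves_nil G st : ssbp_output n s G st -> serves w c n s G st [] 0
| serves_cons G st e es st' t t' :
    ssbp_output n s G st ->
    exec w c (feed e st) st' t ->
    serves w c n s (apply G e) st' es t' ->
    serves w c n s G st (e :: es) (t + t').

(* T bounds the total time for preprocessing and n updates, on n-node graphs with
   weights at most n ^ d. *)
Definition computes_ssbp (m : mode) (d : nat) (P : dynamic_algorithm)
    (T : nat -> nat) : Prop :=
  exists c, forall (n s : nat) (G : graph) (es : list update),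
    s < n -> is_graph n (n ^ d) G -> length es = n ->
    legal_sequence m n (n ^ d) G es ->
    exists st t0 t,
      exec (word_length c n) (setup P) (ssbp_input n s G) st t0 /\
      serves (word_length c n) (react P) n s G st es t /\
      t0 + t <= T n.

(* Algorithms handle arbitrary polynomially bounded weights; as is usual, word
   length and hidden constants may depend on the degree of the polynomial. *)
Definition ssbp_total_time (m : mode) (P : dynamic_algorithm) (f : nat -> R)
  : Prop :=
  forall d, exists T, computes_ssbp m d P T /\ bigO (fun n => INR (T n)) f.

Definition ssbp_amortized_time (m : mode) (P : dynamic_algorithm)
    (f : nat -> R) : Prop :=
  forall d, exists T,
    computes_ssbp m d P T /\ bigO (fun n => (INR (T n) / INR n)%R) f.

(* "Time n^(a - o(1)) is required", in the sense of fine-grained complexity. *)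
Definition requires_exponent {Alg : Type}
    (runs_in : Alg -> (nat -> R) -> Prop) (a : R) : Prop :=
  forall (P : Alg) (eps : R), (0 < eps)%R ->
    ~ runs_in P (fun n => Rpower (INR n) (a - eps)).

(* Main.v *)
From Stdlib Require Import Reals Arith Bool List Lia Lra.
Require Import Defs.
Import ListNotations.

(* Given n x n matrices A and B, take a network s -> i -> k -> j with an edge i -> k
   of weight i n + (n - 1 - k) when A i k, an edge k -> j when B k j, and all other
   weights on these paths equal to n^2.  If s is joined exactly to the rows 0, ..., i, then the
   widest path to j uses row i as soon as it can, and its width reveals the least
   witness for (i, j); so inserting the edges s -> i in increasing order, or deleting
   them in decreasing order, yields the product row by row in n updates.  The network
   has N = 3 n + 5 nodes; the product costs one run of the dynamic algorithm plus
   O(N^2), which is negligible next to N^(5/2 - eps) once eps <= 1/2.  On the word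
   RAM the dynamic algorithm runs on registers and arrays with shifted indices, next
   to those of the surrounding program. *)

(** * Simulation under shifted indices *)

(** What is known about the dynamic algorithm is a bound on the total time of sequences of exactly
    [N] updates; a single call of [react] may consume most of it. The loop rule therefore charges
    each iteration its own time. The sequence is filled up to length [N] by updates at a node that
    the source cannot reach; the program never executes them, and leaving them out only lowers the
    sum. Each stage reads a row and then updates, because the initial graph is already answered:
    with insertions the edge to row 0 is present from the start, and the last insertion goes to a
    dummy row [n] without outgoing edges. An overflowing run has no derivation, so the program must
    be shown to stay within its words. An expression with at most 300 leaves, all bounded by
    [M = N^2], has value at most [M^300], which words of O(log n) bits can hold. The constants [K]
    are quantified before [n] and the matrices, and are read off the costs of the concrete code at
    the end of each proof. *)

Lemma upd_same {X : Type} (f : nat -> X) a x : upd f a x a = x.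
Proof. unfold upd. now rewrite Nat.eqb_refl. Qed.

Lemma upd_other {X : Type} (f : nat -> X) a x b : b <> a -> upd f a x b = f b.
Proof. intros H. unfold upd. now destruct (Nat.eqb_spec b a). Qed.

(** Overflow is a missing derivation rather than a wrap-around, so a run survives unchanged with
    longer words. The dynamic algorithm can thus run inside a program whose words are longer than
    its own. *)
Lemma exec_word_mono w w' c st st' t :
  w <= w' -> exec w c st st' t -> exec w' c st st' t.
Proof.
  intros Hw H. induction H; try (econstructor; eassumption).
  apply exec_assign. eapply Nat.lt_le_trans; [eassumption|].
  apply Nat.pow_le_mono_r; lia.
Qed.

Definition shift_rhs (k : nat) (e : rhs) : rhs :=
  match e with
  | Const v => Const v
  | Binop o y z => Binop o (k + y) (k + z)
  | Fetch a y => Fetch (k + a) (k + y)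
  end.

Fixpoint shift (k : nat) (c : cmd) : cmd :=
  match c with
  | Skip => Skip
  | Assign x e => Assign (k + x) (shift_rhs k e)
  | Store a y z => Store (k + a) (k + y) (k + z)
  | Seq c1 c2 => Seq (shift k c1) (shift k c2)
  | If x c1 c2 => If (k + x) (shift k c1) (shift k c2)
  | While x c => While (k + x) (shift k c)
  end.

Definition hosts (k : nat) (st s : state) : Prop :=
  (forall x, reg s (k + x) = reg st x) /\
  (forall a p, arr s (k + a) p = arr st a p).

Definition same_below (k : nat) (s s' : state) : Prop :=
  (forall x, x < k -> reg s' x = reg s x) /\
  (forall a p, a < k -> arr s' a p = arr s a p).

Lemma same_below_refl k s : same_below k s s.
Proof. now split. Qed.

Lemma same_below_trans k s1 s2 s3 :
  same_below k s1 s2 -> same_below k s2 s3 -> same_below k s1 s3.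
Proof.
  intros [H1 H2] [H3 H4]; split; intros.
  - rewrite H3, H1; auto.
  - rewrite H4, H2; auto.
Qed.

Lemma hosts_set_reg k st s x v :
  hosts k st s -> hosts k (set_reg x v st) (set_reg (k + x) v s).
Proof.
  intros [H1 H2]; split; [intros y | exact H2]. cbn. unfold upd.
  destruct (Nat.eqb_spec y x) as [->|Hn].
  - now rewrite Nat.eqb_refl.
  - destruct (Nat.eqb_spec (k + y) (k + x)); [lia | apply H1].
Qed.

Lemma hosts_set_cell k st s a p v :
  hosts k st s -> hosts k (set_cell a p v st) (set_cell (k + a) p v s).
Proof.
  intros [H1 H2]; split; [exact H1 | intros a' p']. cbn. unfold upd.
  destruct (Nat.eqb_spec a' a) as [->|Hn].
  - rewrite Nat.eqb_refl. destruct (Nat.eqb_spec p' p); auto.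
  - destruct (Nat.eqb_spec (k + a') (k + a)); [lia | apply H2].
Qed.

Lemma same_below_set_reg k s x v : same_below k s (set_reg (k + x) v s).
Proof.
  split; [intros y Hy | easy]. cbn. apply upd_other. lia.
Qed.

Lemma same_below_set_cell k s a p v : same_below k s (set_cell (k + a) p v s).
Proof.
  split; [easy | intros a' p' Ha]. cbn. rewrite upd_other by lia. reflexivity.
Qed.

Lemma eval_shift_rhs k st s e :
  hosts k st s -> eval_rhs s (shift_rhs k e) = eval_rhs st e.
Proof.
  intros [H1 H2]. destruct e; cbn; rewrite ?H1, ?H2; reflexivity.
Qed.

(** The renaming is injective, so steps correspond one to one and the time is preserved exactly.
    Everything below [k] survives the run and is free for the surrounding program. *)
Lemma exec_shift w k c st st' t :
  exec w c st st' t -> forall s, hosts k st s ->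
  exists s', exec w (shift k c) s s' t /\ hosts k st' s' /\ same_below k s s'.
Proof.
  induction 1; intros s Hs; cbn [shift].
  - exists s. split; [constructor|]. split; [auto|apply same_below_refl].
  - exists (set_reg (k + x) (eval_rhs st e) s).
    split; [|split; [now apply hosts_set_reg|apply same_below_set_reg]].
    rewrite <- (eval_shift_rhs k st s e Hs). constructor.
    now rewrite (eval_shift_rhs k st s e Hs).
  - exists (set_cell (k + a) (reg st y) (reg st z) s).
    split; [|split; [now apply hosts_set_cell|apply same_below_set_cell]].
    rewrite <- !(proj1 Hs). constructor.
  - destruct (IHexec1 s Hs) as (s1 & E1 & Hs1 & F1).
    destruct (IHexec2 s1 Hs1) as (s2 & E2 & Hs2 & F2).
    exists s2. split; [econstructor; eauto|]. split; [auto|].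
    eapply same_below_trans; eauto.
  - destruct (IHexec s Hs) as (s1 & E1 & Hs1 & F1).
    exists s1. split; [|auto]. apply exec_if_true; [|auto].
    now rewrite (proj1 Hs).
  - destruct (IHexec s Hs) as (s1 & E1 & Hs1 & F1).
    exists s1. split; [|auto]. apply exec_if_false; [|auto].
    now rewrite (proj1 Hs).
  - destruct (IHexec1 s Hs) as (s1 & E1 & Hs1 & F1).
    destruct (IHexec2 s1 Hs1) as (s2 & E2 & Hs2 & F2).
    exists s2. split; [|split; [auto|eapply same_below_trans; eauto]].
    eapply exec_while_true; eauto. now rewrite (proj1 Hs).
  - exists s. split; [|split; [auto|apply same_below_refl]].
    apply exec_while_false. now rewrite (proj1 Hs).
Qed.

(** The reduction interleaves its own code with the updates and stops early, so the inductive run is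
    unfolded into sequences that a loop invariant can index. [e0] is the default value of [nth]. *)
Lemma serves_trace w c n s e0 G st es t :
  serves w c n s G st es t ->
  exists (graphs : nat -> graph) (states : nat -> state) (times : nat -> nat),
    graphs 0 = G /\ states 0 = st /\
    (forall i, i < length es ->
      graphs (S i) = apply (graphs i) (nth i es e0) /\
      exec w c (feed (nth i es e0) (states i)) (states (S i)) (times i)) /\
    (forall i, i <= length es -> ssbp_output n s (graphs i) (states i)) /\
    list_sum (map times (seq 0 (length es))) = t.
Proof.
  induction 1 as [G st Hout | G st e es st' t t' Hout Hex _ IH].
  - exists (fun _ => G), (fun _ => st), (fun _ => 0).
    do 2 (split; [reflexivity|]). split; [cbn; lia|].
    split; [auto | reflexivity].
  - destruct IH as (g & h & k & Hg & Hh & Hstep & Ho & Ht).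
    exists (fun i => match i with 0 => G | S j => g j end),
      (fun i => match i with 0 => st | S j => h j end),
      (fun i => match i with 0 => t | S j => k j end).
    split; [reflexivity|]. split; [reflexivity|]. split; [|split].
    + intros [|i] Hi; cbn in *; [now rewrite Hg, Hh|]. apply Hstep. lia.
    + intros [|i] Hi; cbn in *; [auto|]. apply Ho. lia.
    + cbn [length seq map]. rewrite <- seq_shift, map_map, <- Ht. reflexivity.
Qed.

(** * Expressions and loops on the word RAM *)

(* Registers below [temp] hold program variables, those in [temp, base) the
   temporaries of expression evaluation, and those from [base] on the registers
   of the simulated dynamic algorithm. *)
Definition temp : nat := 4.
Definition base : nat := 32.

Inductive expr :=
| Num (k : nat)
| Var (x : nat)
| Bin (o : binop) (e1 e2 : expr)
| Cell (a : nat) (e : expr).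

Fixpoint eval (st : state) (e : expr) : nat :=
  match e with
  | Num k => k
  | Var x => reg st x
  | Bin o e1 e2 => eval_binop o (eval st e1) (eval st e2)
  | Cell a e => arr st a (eval st e)
  end.

(** Stack discipline: the value ends in register [d], and a second operand is computed one register
    higher. As there is no move instruction, a copy is the bitwise conjunction of [x] with
    itself. *)
Fixpoint compile (e : expr) (d : nat) : cmd :=
  match e with
  | Num k => Assign d (Const k)
  | Var x => Assign d (Binop And x x)
  | Bin o e1 e2 =>
      Seq (compile e1 d) (Seq (compile e2 (S d)) (Assign d (Binop o d (S d))))
  | Cell a e => Seq (compile e d) (Assign d (Fetch a d))
  end.

Fixpoint cost (e : expr) : nat :=
  match e with
  | Num _ | Var _ => 1
  | Bin _ e1 e2 => cost e1 + (cost e2 + 1)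
  | Cell _ e => cost e + 1
  end.

Fixpoint leaves (e : expr) : nat :=
  match e with
  | Num _ | Var _ => 1
  | Bin _ e1 e2 => leaves e1 + leaves e2
  | Cell _ e => leaves e
  end.

Fixpoint depth (e : expr) : nat :=
  match e with
  | Num _ | Var _ => 1
  | Bin _ e1 e2 => Nat.max (depth e1) (S (depth e2))
  | Cell _ e => depth e
  end.

Definition arithmetic (o : binop) : Prop :=
  match o with
  | Add | Sub | Mul | Div | Mod | Ltb | Eqb => True
  | _ => False
  end.

Fixpoint bounded (M : nat) (st : state) (e : expr) : Prop :=
  match e with
  | Num k => k <= M
  | Var x => x < temp /\ reg st x <= M
  | Bin o e1 e2 => arithmetic o /\ bounded M st e1 /\ bounded M st e2
  | Cell a e => bounded M st e /\ arr st a (eval st e) <= M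
  end.

Lemma leaves_pos e : 1 <= leaves e.
Proof. induction e; cbn; lia. Qed.

Lemma depth_pos e : 1 <= depth e.
Proof. induction e; cbn; lia. Qed.

(** Each [arithmetic] operation stays below the product of its operand bounds; for addition this is
    [u + v <= u * v] with [u, v >= 2], which is where [2 <= M] enters. Hence the leaf count acts as
    an exponent. *)
Lemma eval_le M st e : 2 <= M -> bounded M st e -> eval st e <= M ^ leaves e.
Proof.
  intros HM. induction e as [k|x|o e1 IH1 e2 IH2|a e IH]; cbn [bounded eval leaves].
  - rewrite Nat.pow_1_r. auto.
  - rewrite Nat.pow_1_r. tauto.
  - intros (Ho & H1 & H2). specialize (IH1 H1). specialize (IH2 H2).
    rewrite Nat.pow_add_r.
    assert (P1 : 2 <= M ^ leaves e1).
    { apply (Nat.le_trans _ (M ^ 1)); [rewrite Nat.pow_1_r; lia|].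
      apply Nat.pow_le_mono_r; [lia | apply leaves_pos]. }
    assert (P2 : 2 <= M ^ leaves e2).
    { apply (Nat.le_trans _ (M ^ 1)); [rewrite Nat.pow_1_r; lia|].
      apply Nat.pow_le_mono_r; [lia | apply leaves_pos]. }
    set (u := M ^ leaves e1) in *. set (v := M ^ leaves e2) in *.
    generalize dependent (eval st e2). generalize dependent (eval st e1).
    intros x IH1 y IH2.
    assert (Hx : x <= u * v) by nia.
    destruct o; cbn [arithmetic] in Ho; try tauto; cbn [eval_binop].
    + nia.
    + lia.
    + nia.
    + destruct y as [|y']; [cbn; lia|].
      apply (Nat.le_trans _ x); [apply Nat.Div0.div_le_upper_bound; nia | lia].
    + apply (Nat.le_trans _ x); [apply Nat.Div0.mod_le | lia].
    + destruct (x <? y); cbn; lia.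
    + destruct (x =? y); cbn; lia.
  - intros [H1 H2]. apply (Nat.le_trans _ (M ^ 1)); [rewrite Nat.pow_1_r; lia|].
    apply Nat.pow_le_mono_r; [lia | apply leaves_pos].
Qed.

Lemma eval_agree M st st' e :
  (forall x, x < temp -> reg st' x = reg st x) ->
  (forall a p, arr st' a p = arr st a p) ->
  bounded M st e -> eval st' e = eval st e /\ bounded M st' e.
Proof.
  intros Hr Ha. induction e as [k|x|o e1 IH1 e2 IH2|a e IH]; cbn [bounded eval].
  - auto.
  - intros [H1 H2]. rewrite Hr; auto.
  - intros (Ho & H1 & H2). destruct (IH1 H1) as [-> ?], (IH2 H2) as [-> ?]. auto.
  - intros [H1 H2]. destruct (IH H1) as [-> ?]. rewrite Ha. auto.
Qed.

(** The frame is two-sided: registers below [d] hold operands computed earlier, and those of the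
    simulated algorithm are out of reach as soon as [d + depth e <= base]. *)
Lemma compile_exec w M e : 2 <= M -> M ^ leaves e < 2 ^ w ->
  forall st d, bounded M st e -> temp <= d ->
  exists st', exec w (compile e d) st st' (cost e) /\ reg st' d = eval st e /\
    (forall x, x < d \/ d + depth e <= x -> reg st' x = reg st x) /\
    (forall a p, arr st' a p = arr st a p).
Proof.
  intros HM. induction e as [k|x|o e1 IH1 e2 IH2|a e IH];
    intros Hw st d Hb Hd; pose proof (eval_le M st _ HM Hb) as Hv.
  - eexists. split; [apply exec_assign; cbn in *; lia|]. cbn.
    rewrite upd_same. repeat split. intros. apply upd_other. lia.
  - eexists. split; [apply exec_assign|]; cbn [eval_rhs eval_binop];
      rewrite Nat.land_diag; [cbn [eval] in Hv; lia|]. cbn.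
    rewrite upd_same. repeat split. intros. apply upd_other. lia.
  - cbn [leaves] in Hw. cbn [bounded] in Hb. destruct Hb as (Ho & Hb1 & Hb2).
    assert (M ^ leaves e1 <= M ^ (leaves e1 + leaves e2))
      by (apply Nat.pow_le_mono_r; lia).
    assert (M ^ leaves e2 <= M ^ (leaves e1 + leaves e2))
      by (apply Nat.pow_le_mono_r; lia).
    destruct (IH1 ltac:(lia) st d Hb1 Hd) as (st1 & E1 & V1 & R1 & A1).
    destruct (eval_agree M st st1 e2) as [V2' Hb2']; [|assumption..|].
    { intros y Hy. apply R1. lia. }
    destruct (IH2 ltac:(lia) st1 (S d) Hb2' ltac:(lia)) as (st2 & E2 & V2 & R2 & A2).
    eexists. split; [|cbn [compile]].
    { cbn [compile cost]. econstructor; [exact E1|]. econstructor; [exact E2|].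
      apply exec_assign. cbn [eval_rhs]. rewrite V2, V2', (R2 d), V1 by lia.
      cbn [leaves eval] in Hv. lia. }
    cbn [eval_rhs]. rewrite V2, V2', (R2 d), V1 by lia. cbn. rewrite upd_same.
    split; [reflexivity|]. split.
    + intros y Hy. rewrite upd_other by lia. rewrite R2, R1; lia.
    + intros. now rewrite A2, A1.
  - cbn [leaves] in *. cbn [bounded] in Hb. destruct Hb as (Hb & Hc).
    destruct (IH Hw st d Hb Hd) as (st1 & E1 & V1 & R1 & A1).
    eexists. split.
    { cbn [compile cost]. econstructor; [exact E1|].
      apply exec_assign. cbn [eval_rhs]. rewrite V1, A1.
      cbn [eval] in Hv. lia. }
    cbn [eval_rhs]. rewrite V1, A1. cbn. rewrite upd_same.
    split; [reflexivity|]. split.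
    + intros y Hy. pose proof (depth_pos e).
      rewrite upd_other by lia. now apply R1.
    + intros. now rewrite A1.
Qed.

(** * Hoare triples with time bounds *)

Definition runs (w : nat) (c : cmd) (st : state) (t : nat) (Q : state -> Prop)
  : Prop :=
  exists st' t', exec w c st st' t' /\ t' <= t /\ Q st'.

Lemma runs_mono w c st t t' (Q Q' : state -> Prop) :
  runs w c st t Q -> t <= t' -> (forall st', Q st' -> Q' st') ->
  runs w c st t' Q'.
Proof.
  intros (st' & t0 & E & Ht & HQ) Hle HQQ. exists st', t0.
  split; [auto|]. split; [lia | auto].
Qed.

Lemma runs_le w c st t t' Q : runs w c st t Q -> t <= t' -> runs w c st t' Q.
Proof. intros H Hle. apply (runs_mono w c st t t' Q Q); auto. Qed.

Lemma runs_seq w c1 c2 st t1 t2 (Q : state -> Prop) :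
  runs w c1 st t1 (fun st1 => runs w c2 st1 t2 Q) ->
  runs w (Seq c1 c2) st (t1 + t2) Q.
Proof.
  intros (st1 & u1 & E1 & H1 & st2 & u2 & E2 & H2 & HQ).
  exists st2, (u1 + u2). split; [econstructor; eauto|]. split; [lia | auto].
Qed.

Lemma runs_shift w k c st st' t s :
  exec w c st st' t -> hosts k st s ->
  runs w (shift k c) s t (fun s' => hosts k st' s' /\ same_below k s s').
Proof.
  intros E H. destruct (exec_shift w k c st st' t E s H) as (s' & E' & H').
  exists s', t. auto.
Qed.

Definition same_visible (st st' : state) : Prop :=
  (forall x, x < temp \/ base <= x -> reg st' x = reg st x) /\
  (forall a p, arr st' a p = arr st a p).

Lemma same_visible_trans s1 s2 s3 :
  same_visible s1 s2 -> same_visible s2 s3 -> same_visible s1 s3.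
Proof.
  intros [H1 H2] [H3 H4]; split; intros.
  - rewrite H3, H1; auto.
  - rewrite H4, H2; auto.
Qed.

(** Evaluation takes place in the temporaries, followed by one copy, so [x] may also be a register
    of the simulated algorithm. *)
Definition set_var (x : nat) (e : expr) : cmd :=
  Seq (compile e temp) (Assign x (Binop And temp temp)).

Definition put (a : nat) (e1 e2 : expr) : cmd :=
  Seq (compile e1 temp)
    (Seq (compile e2 (S temp)) (Store a temp (S temp))).

Definition for_loop (x : nat) (e : expr) (body : cmd) : cmd :=
  Seq (set_var x (Num 0))
    (Seq (compile (Bin Ltb (Var x) e) temp)
      (While temp
        (Seq body
          (Seq (set_var x (Bin Add (Var x) (Num 1)))
            (compile (Bin Ltb (Var x) e) temp))))).

(* Values stay below M ^ leaves e <= M ^ D < 2 ^ w, so that nothing overflows. *)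
Definition fits (w M D : nat) : Prop := 2 <= M /\ M ^ D < 2 ^ w.

Lemma fits_pow w M D k : fits w M D -> k <= D -> M ^ k < 2 ^ w.
Proof.
  intros [HM HD] Hk. eapply Nat.le_lt_trans; [|exact HD].
  apply Nat.pow_le_mono_r; lia.
Qed.

Lemma runs_compile w M D e st :
  fits w M D -> leaves e <= D -> temp + depth e <= base -> bounded M st e ->
  runs w (compile e temp) st (cost e)
    (fun st' => reg st' temp = eval st e /\ same_visible st st').
Proof.
  intros HF HL HD HB.
  destruct (compile_exec w M e (proj1 HF) (fits_pow _ _ _ _ HF HL) st temp HB)
    as (st' & E & V & R & A); [lia|].
  exists st', (cost e). split; [auto|]. split; [lia|]. split; [auto|].
  split; [|auto]. intros x Hx. apply R. lia.
Qed.

Lemma runs_set_var w M D x e st :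
  fits w M D -> leaves e <= D -> temp + depth e <= base -> bounded M st e ->
  runs w (set_var x e) st (S (cost e))
    (same_visible (set_reg x (eval st e) st)).
Proof.
  intros HF HL HD HB.
  destruct (runs_compile w M D e st HF HL HD HB) as (st' & t & E & Ht & V & R & A).
  exists (set_reg x (eval st e) st'), (t + 1). split; [|split].
  - econstructor; [exact E|].
    assert (Hv : eval_rhs st' (Binop And temp temp) = eval st e)
      by (cbn [eval_rhs eval_binop]; rewrite Nat.land_diag; exact V).
    rewrite <- Hv. apply exec_assign. rewrite Hv.
    eapply Nat.le_lt_trans; [apply (eval_le M); [apply HF|auto]|].
    eapply fits_pow; eauto.
  - lia.
  - split; [|auto]. intros y Hy. cbn. unfold upd.
    destruct (y =? x); auto.
Qed.

Lemma runs_put w M D a e1 e2 st :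
  fits w M D -> leaves e1 <= D -> leaves e2 <= D ->
  temp + depth e1 <= base -> S temp + depth e2 <= base ->
  bounded M st e1 -> bounded M st e2 ->
  runs w (put a e1 e2) st (cost e1 + cost e2 + 1)
    (same_visible (set_cell a (eval st e1) (eval st e2) st)).
Proof.
  intros HF HL1 HL2 HD1 HD2 HB1 HB2.
  destruct (runs_compile w M D e1 st HF HL1 HD1 HB1) as (st1 & t & E & Ht & V & R & A).
  destruct (eval_agree M st st1 e2) as [V2' HB2']; [|assumption..|].
  { intros x Hx. apply R. auto. }
  destruct (compile_exec w M e2 (proj1 HF) (fits_pow _ _ _ _ HF HL2) st1 (S temp) HB2')
    as (st2 & E2 & V2 & R2 & A2); [lia|].
  exists (set_cell a (eval st e1) (eval st e2) st2), (t + (cost e2 + 1)).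
  split; [|split].
  - econstructor; [exact E|]. econstructor; [exact E2|].
    rewrite <- V2', <- V2, <- V, <- (R2 temp) by lia. constructor.
  - lia.
  - split.
    + intros x Hx. cbn. rewrite R2 by lia. auto.
    + intros a' p. cbn. unfold upd. destruct (a' =? a).
      * destruct (p =? eval st e1); [auto|]. now rewrite A2, A.
      * now rewrite A2, A.
Qed.

(** [tb] depends on the iteration because only the sum of the [react] times is controlled. The body
    must yield [I (S i)] in every state that agrees with the incremented one outside the
    temporaries; this absorbs the counter update and the new evaluation of the guard. Per round,
    loop control takes at most [cost e + 7] steps; the extra summand in [S n] pays for
    initialisation and exit. *)
Lemma runs_for w M D x e body st n (I : nat -> state -> Prop) (tb : nat -> nat) :
  fits w M D -> S (leaves e) <= D -> 2 <= D -> S temp + depth e <= base ->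
  x < temp -> 1 <= M -> n <= M ->
  (forall st1, same_visible (set_reg x 0 st) st1 -> I 0 st1) ->
  (forall i st1, i <= n -> I i st1 ->
    reg st1 x = i /\ eval st1 e = n /\ bounded M st1 e) ->
  (forall i st1, i < n -> I i st1 ->
    runs w body st1 (tb i) (fun st2 => reg st2 x = i /\
      forall st3, same_visible (set_reg x (S i) st2) st3 -> I (S i) st3)) ->
  runs w (for_loop x e body) st
    (list_sum (map tb (seq 0 n)) + S n * (cost e + 8)) (I n).
Proof.
  intros HF HL HD2 HD Hx HM HnM HI0 HI Hbody.
  assert (Hflag : forall i st1, i <= n -> I i st1 ->
    runs w (compile (Bin Ltb (Var x) e) temp) st1 (cost e + 2)
      (fun st2 => reg st2 temp = Nat.b2n (i <? n) /\ same_visible st1 st2)).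
  { intros i st1 Hi H1. destruct (HI i st1 Hi H1) as (Hr & He & Hb).
    eapply runs_mono.
    - apply (runs_compile w M D); [auto|cbn; lia| |].
      + cbn [depth]. lia.
      + cbn [bounded arithmetic]. split; [auto|]. split; [|auto]. split; [auto|lia].
    - cbn [cost]. lia.
    - cbn [eval eval_binop]. rewrite Hr, He. auto. }
  assert (Hloop : forall k i st1, i + k = n -> I i st1 ->
    reg st1 temp = Nat.b2n (i <? n) ->
    runs w (While temp (Seq body
      (Seq (set_var x (Bin Add (Var x) (Num 1)))
        (compile (Bin Ltb (Var x) e) temp)))) st1
      (list_sum (map tb (seq i k)) + k * (cost e + 8) + 1) (I n)).
  { induction k as [|k IH]; intros i st1 Hik H1 Hfl.
    - exists st1, 1. replace i with n in * by lia. rewrite Nat.ltb_irrefl in Hfl.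
      split; [now apply exec_while_false|]. split; [lia|auto].
    - destruct (Hbody i st1 ltac:(lia) H1) as (st2 & t2 & E2 & Ht2 & Hr2 & Hnext).
      assert (Hset : runs w (set_var x (Bin Add (Var x) (Num 1))) st2 4
        (same_visible (set_reg x (S i) st2))).
      { replace (S i) with (eval st2 (Bin Add (Var x) (Num 1)))
          by (cbn; rewrite Hr2; lia).
        apply (runs_set_var w M D); [auto|cbn; lia|cbn; unfold temp, base; lia|].
        cbn. repeat split; lia. }
      destruct Hset as (st3 & t3 & E3 & Ht3 & S3).
      destruct (Hflag (S i) st3 ltac:(lia) (Hnext _ S3)) as (st4 & t4 & E4 & Ht4 & F4 & S4).
      destruct (IH (S i) st4 ltac:(lia)) as (st5 & t5 & E5 & Ht5 & H5).
      + apply Hnext. eapply same_visible_trans; eauto.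
      + exact F4.
      + exists st5, (S ((t2 + (t3 + t4)) + t5)). split; [|split; [|auto]].
        * eapply exec_while_true; [|econstructor; [exact E2|econstructor; eauto]|exact E5].
          rewrite Hfl. destruct (Nat.ltb_spec i n); [cbn; lia | lia].
        * cbn [seq map list_sum fold_right]. unfold list_sum in *. cbn. lia. }
  assert (Hset : runs w (set_var x (Num 0)) st 2 (same_visible (set_reg x 0 st))).
  { change 0 with (eval st (Num 0)) at 2.
    apply (runs_set_var w M D); [auto|cbn; lia|cbn; unfold temp, base; lia|].
    cbn. lia. }
  destruct Hset as (st1 & t1 & E1 & Ht1 & S1).
  destruct (Hflag 0 st1 ltac:(lia) (HI0 _ S1)) as (st2 & t2 & E2 & Ht2 & F2 & S2).
  destruct (Hloop n 0 st2 ltac:(lia)) as (st3 & t3 & E3 & Ht3 & H3).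
  - apply HI0. eapply same_visible_trans; eauto.
  - exact F2.
  - exists st3, (t1 + (t2 + t3)). split; [|split; [lia|auto]].
    econstructor; [exact E1|]. econstructor; eauto.
Qed.

(** * The network *)

(** Expressions have no conditional, so the encoded entry of [net] is a sum of products of
    indicators, at most one summand being nonzero. Weights are raised by 1 as in [encode]: [n - k]
    replaces [n - 1 - k], and padding edges of weight 0 contribute 1. Outside its range a truncated
    difference reads some other cell, which an indicator multiplies by 0. *)
Definition code (m : mode) (n : nat) (a b : nat -> nat) (c u v : nat) : nat :=
  Nat.b2n (u <? n) * Nat.b2n (n <? v) * Nat.b2n (v <? n + n + 1)
    * a (u * n + (v - (n + 1))) * (u * n + (n - (v - (n + 1))))
  + Nat.b2n (n <? u) * Nat.b2n (u <? n + n + 1)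
    * Nat.b2n (n + n + 1 <? v) * Nat.b2n (v <? n + n + n + 2)
    * b ((u - (n + 1)) * n + (v - (n + n + 2))) * (n * n + 1)
  + Nat.b2n (u =? n + n + n + 3) * Nat.b2n (v <? c) * (n * n + 1)
  + match m with
    | Incremental => 0
    | Decremental =>
        Nat.b2n (u =? n + n + n + 4) * Nat.b2n (v <? n + n + n + 4)
    end.

(* Nodes: i <= n for rows, n+1+k for the inner index, 2n+2+j for columns, the
   source 3n+3, and 3n+4, which is unreachable and only pads the update sequence.
   An inner edge of row i outweighs all those of smaller rows, so a column sees
   only the last row c-1 attached to the source. *)
Definition net (m : mode) (n : nat) (A B : nat -> nat -> bool) (c : nat) : graph :=
  fun u v =>
    if u <? n then
      if (n <? v) && (v <? n + n + 1) && A u (v - (n + 1))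
      then Some (u * n + (n - 1 - (v - (n + 1)))) else None
    else if u =? n then None
    else if u <? n + n + 1 then
      if (n + n + 1 <? v) && (v <? n + n + n + 2) && B (u - (n + 1)) (v - (n + n + 2))
      then Some (n * n) else None
    else if u =? n + n + n + 3 then
      if v <? c then Some (n * n) else None
    else if u =? n + n + n + 4 then
      match m with
      | Incremental => None
      | Decremental => if v <? n + n + n + 4 then Some 0 else None
      end
    else None.

Lemma row_major_at n f i k : i < n -> k < n -> row_major n f (i * n + k) = f i k.
Proof.
  intros Hi Hk. unfold row_major.
  destruct (Nat.ltb_spec (i * n + k) (n * n)); [|nia].
  f_equal.
  - symmetry. apply (Nat.div_unique _ _ _ k); lia.
  - symmetry. apply (Nat.mod_unique _ _ i); lia.
Qed.

Local Ltac collapse :=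
  cbn [encode Nat.b2n andb];
  repeat (rewrite Nat.mul_0_l || rewrite Nat.mul_0_r || rewrite Nat.mul_1_l); lia.

Lemma encode_net m n A B c u v :
  encode (net m n A B c u v) =
  code m n (row_major n (fun i k => Nat.b2n (A i k)))
    (row_major n (fun k j => Nat.b2n (B k j))) c u v.
Proof.
  unfold net, code.
  destruct (Nat.ltb_spec u n).
  - replace (n <? u) with false by (symmetry; apply Nat.ltb_ge; lia).
    replace (u =? n + n + n + 3) with false by (symmetry; apply Nat.eqb_neq; lia).
    replace (u =? n + n + n + 4) with false by (symmetry; apply Nat.eqb_neq; lia).
    destruct (Nat.ltb_spec n v); [|destruct m; collapse].
    destruct (Nat.ltb_spec v (n + n + 1)); [|destruct m; collapse].
    rewrite row_major_at by lia. cbv beta.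
    destruct (A u (v - (n + 1))); destruct m; collapse.
  - destruct (Nat.eqb_spec u n) as [->|].
    { rewrite Nat.ltb_irrefl.
      replace (n =? n + n + n + 3) with false by (symmetry; apply Nat.eqb_neq; lia).
      replace (n =? n + n + n + 4) with false by (symmetry; apply Nat.eqb_neq; lia).
      destruct m; reflexivity. }
    replace (n <? u) with true by (symmetry; apply Nat.ltb_lt; lia).
    destruct (Nat.ltb_spec u (n + n + 1)).
    + replace (u =? n + n + n + 3) with false by (symmetry; apply Nat.eqb_neq; lia).
      replace (u =? n + n + n + 4) with false by (symmetry; apply Nat.eqb_neq; lia).
      destruct (Nat.ltb_spec (n + n + 1) v); [|destruct m; collapse].
      destruct (Nat.ltb_spec v (n + n + n + 2)); [|destruct m; collapse].
      rewrite (row_major_at n _ (u - (n + 1)) (v - (n + n + 2))) by lia. cbv beta.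
      destruct (B (u - (n + 1)) (v - (n + n + 2))); destruct m; collapse.
    + destruct (Nat.eqb_spec u (n + n + n + 3)).
      * replace (u =? n + n + n + 4) with false by (symmetry; apply Nat.eqb_neq; lia).
        destruct (v <? c); destruct m; collapse.
      * destruct (u =? n + n + n + 4), m; try (destruct (v <? _)); collapse.
Qed.

Lemma net_edge m n A B c u v w : net m n A B c u v = Some w ->
  (u < n /\ exists k, k < n /\ v = n + 1 + k /\ A u k = true /\
    w = u * n + (n - 1 - k)) \/
  (exists k j, k < n /\ j < n /\ u = n + 1 + k /\ v = n + n + 2 + j /\
    B k j = true /\ w = n * n) \/
  (u = n + n + n + 3 /\ v < c /\ w = n * n) \/
  (m = Decremental /\ u = n + n + n + 4 /\ v < n + n + n + 4 /\ w = 0).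
Proof.
  unfold net.
  destruct (Nat.ltb_spec u n).
  { destruct (Nat.ltb_spec n v); [|easy].
    destruct (Nat.ltb_spec v (n + n + 1)); [|easy].
    cbn [andb]. destruct (A u (v - (n + 1))) eqn:HA; [|easy].
    intros [= <-]. left. split; [auto|]. exists (v - (n + 1)).
    repeat split; auto; lia. }
  destruct (Nat.eqb_spec u n); [easy|].
  destruct (Nat.ltb_spec u (n + n + 1)).
  { destruct (Nat.ltb_spec (n + n + 1) v); [|easy].
    destruct (Nat.ltb_spec v (n + n + n + 2)); [|easy].
    cbn [andb]. destruct (B (u - (n + 1)) (v - (n + n + 2))) eqn:HB; [|easy].
    intros [= <-]. right; left. exists (u - (n + 1)), (v - (n + n + 2)).
    repeat split; auto; lia. }
  destruct (Nat.eqb_spec u (n + n + n + 3)).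
  { destruct (Nat.ltb_spec v c); [|easy].
    intros [= <-]. right; right; left. auto. }
  destruct (Nat.eqb_spec u (n + n + n + 4)); [|easy].
  destruct m; [easy|].
  destruct (Nat.ltb_spec v (n + n + n + 4)); [|easy].
  intros [= <-]. do 3 right. auto.
Qed.

Lemma net_row_edge m n A B c i k : i < n -> k < n -> A i k = true ->
  net m n A B c i (n + 1 + k) = Some (i * n + (n - 1 - k)).
Proof.
  intros Hi Hk HA. unfold net.
  destruct (Nat.ltb_spec i n); [|lia].
  destruct (Nat.ltb_spec n (n + 1 + k)); [|lia].
  destruct (Nat.ltb_spec (n + 1 + k) (n + n + 1)); [|lia].
  replace (n + 1 + k - (n + 1)) with k by lia. cbn [andb]. now rewrite HA.
Qed.

Lemma net_column_edge m n A B c k j : k < n -> j < n -> B k j = true ->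
  net m n A B c (n + 1 + k) (n + n + 2 + j) = Some (n * n).
Proof.
  intros Hi Hk HB. unfold net.
  destruct (Nat.ltb_spec (n + 1 + k) n); [lia|].
  destruct (Nat.eqb_spec (n + 1 + k) n); [lia|].
  destruct (Nat.ltb_spec (n + 1 + k) (n + n + 1)); [|lia].
  destruct (Nat.ltb_spec (n + n + 1) (n + n + 2 + j)); [|lia].
  destruct (Nat.ltb_spec (n + n + 2 + j) (n + n + n + 2)); [|lia].
  replace (n + 1 + k - (n + 1)) with k by lia.
  replace (n + n + 2 + j - (n + n + 2)) with j by lia. cbn [andb]. now rewrite HB.
Qed.

Lemma net_source m n A B c v :
  net m n A B c (n + n + n + 3) v = if v <? c then Some (n * n) else None.
Proof.
  unfold net.
  destruct (Nat.ltb_spec (n + n + n + 3) n); [lia|].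
  destruct (Nat.eqb_spec (n + n + n + 3) n); [lia|].
  destruct (Nat.ltb_spec (n + n + n + 3) (n + n + 1)); [lia|].
  now rewrite Nat.eqb_refl.
Qed.

Lemma net_pad m n A B c v :
  net m n A B c (n + n + n + 4) v =
  match m with
  | Incremental => None
  | Decremental => if v <? n + n + n + 4 then Some 0 else None
  end.
Proof.
  unfold net.
  destruct (Nat.ltb_spec (n + n + n + 4) n); [lia|].
  destruct (Nat.eqb_spec (n + n + n + 4) n); [lia|].
  destruct (Nat.ltb_spec (n + n + n + 4) (n + n + 1)); [lia|].
  destruct (Nat.eqb_spec (n + n + n + 4) (n + n + n + 3)); [lia|].
  now rewrite Nat.eqb_refl.
Qed.

Lemma net_independent m n A B c c' u v : u <> n + n + n + 3 ->
  net m n A B c u v = net m n A B c' u v.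
Proof.
  intros Hu. unfold net. destruct (Nat.eqb_spec u (n + n + n + 3)); [lia|].
  reflexivity.
Qed.

Lemma net_is_graph m n A B c :
  c <= S n -> is_graph (n + n + n + 5) ((n + n + n + 5) ^ 2) (net m n A B c).
Proof.
  intros Hc u v w H. rewrite Nat.pow_2_r.
  destruct (net_edge _ _ _ _ _ _ _ _ H)
    as [(Hu & k & Hk & -> & _ & ->) | [(k & j & Hk & Hj & -> & -> & _ & ->)
       | [(-> & Hv & ->) | (_ & -> & Hv & ->)]]]; repeat split; nia.
Qed.

(** The layers force three edges from the source to a column, and columns have no outgoing edges.
    The outer weights [n * n] exceed every middle weight, so the width is the middle one. Agreement
    of [G] with [net] is pointwise because [G] arises from updates. *)
Lemma net_path_width m n A B c G j b :
  (forall u v, G u v = net m n A B c u v) -> c <= n -> j < n ->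
  path_width G (n + n + n + 3) (n + n + 2 + j) b <->
  exists i k, i < c /\ k < n /\ A i k = true /\ B k j = true /\
    b = i * n + (n - 1 - k).
Proof.
  intros HG Hc Hj. split.
  - intros (p & ws & Hw & _ & Hin & Hall).
    inversion Hw as [|? x1 p1 ? w1 ws1 E1 W1]; subst; [lia|].
    rewrite HG in E1. apply net_edge in E1.
    destruct E1 as [(? & _) | [(? & ? & ? & ? & ? & _) | [(_ & Hx1 & ->) | (_ & ? & _)]]];
      try lia.
    inversion W1 as [|? x2 p2 ? w2 ws2 E2 W2]; subst; [lia|].
    rewrite HG in E2. apply net_edge in E2.
    destruct E2 as [(_ & k & Hk & -> & HA & ->) | [(? & ? & ? & ? & ? & _) | [(? & _) | (_ & ? & _)]]];
      try lia.
    inversion W2 as [|? x3 p3 ? w3 ws3 E3 W3]; subst; [lia|].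
    rewrite HG in E3. apply net_edge in E3.
    destruct E3 as [(? & _) | [(k' & j' & Hk' & Hj' & ? & -> & HB & ->) | [(? & _) | (_ & ? & _)]]];
      try lia.
    assert (k' = k) by lia; subst k'.
    assert (j' = j /\ ws3 = []) as [-> ->].
    { inversion W3 as [|? x4 p4 ? w4 ws4 E4 W4]; subst; [split; [lia|reflexivity]|].
      rewrite HG in E4. apply net_edge in E4.
      destruct E4 as [(? & _) | [(? & ? & ? & ? & ? & _) | [(? & _) | (_ & ? & _)]]]; lia. }
    exists x1, k. repeat split; auto.
    apply Forall_inv_tail in Hall. apply Forall_inv in Hall.
    cbn in Hin. nia.
  - intros (i & k & Hi & Hk & HA & HB & ->).
    exists [i; n + 1 + k; n + n + 2 + j], [n * n; i * n + (n - 1 - k); n * n].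
    split; [|split; [|split]].
    + econstructor; [|econstructor; [|econstructor; [|constructor]]]; rewrite HG.
      * rewrite net_source. destruct (Nat.ltb_spec i c); [reflexivity|lia].
      * apply net_row_edge; auto; lia.
      * now apply net_column_edge.
    + repeat constructor; cbn; lia.
    + cbn. auto.
    + repeat constructor; nia.
Qed.

(** Row [c - 1] owns the widths from [(c - 1) * n] to [c * n - 1], and nothing wider occurs while
    [c] rows are attached; the first factor tests whether the encoded width [x] is in this block. If
    [x = S ((c - 1) * n + (n - 1 - k))], the second factor is [S k]. Smaller [x], including 0 for an
    unreachable column, give 0, the code of [None]. *)
Definition decode (n c x : nat) : nat :=
  Nat.b2n ((c - 1) * n <? x) * (c * n + 1 - x).

(** A maximum below the block of row [i] excludes witnesses, since each of them would give a wider
    path. The bound on [encode o] is what later keeps [read_row] from overflowing. *)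
Lemma decode_bottleneck m n A B i G j o :
  (forall u v, G u v = net m n A B (S i) u v) -> i < n -> j < n ->
  bottleneck G (n + n + n + 3) (n + n + 2 + j) o ->
  encode o <= n * n /\
  exists o', is_least (witness n A B i j) o' /\ decode n (S i) (encode o) = encode o'.
Proof.
  intros HG Hi Hj Ho.
  assert (HP := fun b => net_path_width m n A B (S i) G j b HG Hi Hj).
  unfold decode. replace (S i - 1) with i by lia.
  destruct o as [b|]; cbn [bottleneck is_greatest encode] in *.
  - destruct Ho as [Hb Hmax]. apply HP in Hb.
    destruct Hb as (i' & k & Hi' & Hk & HA & HB & Eb).
    split; [nia|].
    assert (Hwit : forall k', witness n A B i j k' -> i * n + (n - 1 - k') <= b).
    { intros k' (Hk' & HA' & HB'). apply Hmax, HP. exists i, k'. repeat split; auto. }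
    destruct (Nat.ltb_spec (i * n) (S b)) as [Hlt|Hge]; cbn [Nat.b2n].
    + assert (i' = i) by nia; subst i'.
      exists (Some k). split; [split; [now repeat split|]|].
      * intros k' Hk'. specialize (Hwit k' Hk'). destruct Hk' as [Hk' _]. lia.
      * cbn [encode]. lia.
    + exists None. split; [|reflexivity].
      intros k' Hk'. specialize (Hwit k' Hk'). lia.
  - split; [lia|]. exists None. split; [|rewrite (proj2 (Nat.ltb_ge _ _)); [reflexivity|lia]].
    intros k (Hk & HA & HB). apply (Ho (i * n + (n - 1 - k))), HP.
    exists i, k. repeat split; auto.
Qed.

(** * The update sequence *)

Lemma legal_sequence_distinct m n W es : NoDup (map fst es) ->
  forall G, (forall e, In e es -> legal m n W G e) -> legal_sequence m n W G es.
Proof.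
  induction es as [|e es IH]; intros Hnd G Hleg; [exact I|].
  cbn in Hnd. apply NoDup_cons_iff in Hnd. destruct Hnd as [Hnin Hnd].
  split; [apply Hleg; now left|]. apply (IH Hnd).
  intros e' He'. specialize (Hleg e' (or_intror He')).
  destruct e as [[u v] x], e' as [[u' v'] x'].
  (* The edges are distinct, so an update leaves the entries of all later ones untouched, and
     legality can be checked in the initial graph. *)
  assert (HG : apply G (u, v, x) u' v' = G u' v').
  { cbn. unfold upd.
    destruct (Nat.eqb_spec u' u); [|reflexivity].
    destruct (Nat.eqb_spec v' v); [|congruence]. subst.
    exfalso. apply Hnin. apply (in_map fst) in He'. exact He'. }
  unfold legal in *. rewrite HG. exact Hleg.
Qed.

(** Stage [t] reads row [attached m n t - 1] before its update. The initial value is thus 1 for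
    insertions and [n] for deletions. *)
Definition attached (m : mode) (n t : nat) : nat :=
  match m with Incremental => S t | Decremental => n - t end.

Definition stage_update (m : mode) (n t : nat) : update :=
  match m with
  | Incremental => (n + n + n + 3, S t, Some (n * n))
  | Decremental => (n + n + n + 3, n - t - 1, None)
  end.

Definition pad_update (m : mode) (n v : nat) : update :=
  (n + n + n + 4, v,
   match m with Incremental => Some 0 | Decremental => None end).

Definition schedule (m : mode) (n : nat) : list update :=
  map (stage_update m n) (seq 0 n) ++ map (pad_update m n) (seq 0 (n + n + 5)).

Lemma schedule_length m n : length (schedule m n) = n + n + n + 5.
Proof.
  unfold schedule. rewrite length_app, !length_map, !length_seq. lia.
Qed.

Lemma schedule_nth m n t e : t < n -> nth t (schedule m n) e = stage_update m n t.
Proof.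
  intros Ht. unfold schedule.
  rewrite app_nth1 by (rewrite length_map, length_seq; lia).
  rewrite nth_indep with (d' := stage_update m n 0)
    by (rewrite length_map, length_seq; lia).
  rewrite map_nth, seq_nth by lia. reflexivity.
Qed.

(** [1 <= n] gives [n + n + 5 <= n + n + n + 4]: no padding edge is a loop, and for deletions all of
    them are present. *)
Lemma schedule_legal m n A B : 1 <= n ->
  legal_sequence m (n + n + n + 5) ((n + n + n + 5) ^ 2)
    (net m n A B (attached m n 0)) (schedule m n).
Proof.
  intros Hn. apply legal_sequence_distinct.
  - unfold schedule. rewrite map_app, !map_map. apply NoDup_app.
    + apply NoDup_map_NoDup_ForallPairs; [|apply seq_NoDup].
      intros a b Ha Hb. apply in_seq in Ha, Hb.
      destruct m; cbn; intros [= E]; lia.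
    + apply NoDup_map_NoDup_ForallPairs; [|apply seq_NoDup].
      intros a b _ _. cbn. intros [= E]; lia.
    + intros e H1 H2. apply in_map_iff in H1, H2.
      destruct H1 as (a & <- & _), H2 as (b & E & _).
      destruct m; cbn in E; injection E; lia.
  - intros e He. apply in_app_iff in He. destruct He as [He|He];
      apply in_map_iff in He; destruct He as (t & <- & Ht); apply in_seq in Ht.
    + destruct m; cbn -[Nat.pow]; (split; [lia|]); (split; [lia|]); (split; [lia|]);
        rewrite net_source.
      * split; [now rewrite (proj2 (Nat.ltb_ge _ _)) by lia|].
        exists (n * n). split; [rewrite Nat.pow_2_r; nia|reflexivity].
      * rewrite (proj2 (Nat.ltb_lt _ _)) by lia. easy.
    + destruct m; cbn -[Nat.pow]; (split; [lia|]); (split; [lia|]); (split; [lia|]);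
        rewrite net_pad.
      * split; [reflexivity|]. exists 0. split; [lia|reflexivity].
      * rewrite (proj2 (Nat.ltb_lt _ _)) by lia. easy.
Qed.

Lemma apply_stage_update m n A B t G : t < n ->
  (forall u v, G u v = net m n A B (attached m n t) u v) ->
  forall u v, apply G (stage_update m n t) u v = net m n A B (attached m n (S t)) u v.
Proof.
  intros Ht HG u v. destruct (Nat.eq_dec u (n + n + n + 3)) as [->|Hu].
  - rewrite net_source. destruct m; cbn [apply stage_update attached];
      rewrite upd_same; unfold upd; rewrite HG, net_source; cbn [attached].
    + destruct (Nat.eqb_spec v (S t)) as [->|].
      * rewrite (proj2 (Nat.ltb_lt _ _)) by lia. reflexivity.
      * destruct (Nat.ltb_spec v (S t)), (Nat.ltb_spec v (S (S t))); auto; lia.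
    + destruct (Nat.eqb_spec v (n - t - 1)) as [->|].
      * rewrite (proj2 (Nat.ltb_ge _ _)) by lia. reflexivity.
      * destruct (Nat.ltb_spec v (n - t)), (Nat.ltb_spec v (n - S t)); auto; lia.
  - rewrite (net_independent _ _ _ _ _ (attached m n t)), <- HG by auto.
    destruct m; cbn; now rewrite upd_other.
Qed.

(** * The reduction *)

Definition triple_plus (k : nat) : expr :=
  Bin Add (Bin Add (Bin Add (Var 0) (Var 0)) (Var 0)) (Num k).

Definition double_plus (k : nat) : expr :=
  Bin Add (Bin Add (Var 0) (Var 0)) (Num k).

Definition code_expr (m : mode) (c u v : expr) : expr :=
  let n := Var 0 in
  let n1 := Bin Add n (Num 1) in
  Bin Add
    (Bin Add
      (Bin Add
        (Bin Mul (Bin Mul (Bin Mul (Bin Mul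
          (Bin Ltb u n) (Bin Ltb n v)) (Bin Ltb v (double_plus 1)))
          (Cell 0 (Bin Add (Bin Mul u n) (Bin Sub v n1))))
          (Bin Add (Bin Mul u n) (Bin Sub n (Bin Sub v n1))))
        (Bin Mul (Bin Mul (Bin Mul (Bin Mul (Bin Mul
          (Bin Ltb n u) (Bin Ltb u (double_plus 1))) (Bin Ltb (double_plus 1) v))
          (Bin Ltb v (triple_plus 2)))
          (Cell 1 (Bin Add (Bin Mul (Bin Sub u n1) n) (Bin Sub v (double_plus 2)))))
          (Bin Add (Bin Mul n n) (Num 1))))
      (Bin Mul (Bin Mul (Bin Eqb u (triple_plus 3)) (Bin Ltb v c))
        (Bin Add (Bin Mul n n) (Num 1))))
    (match m with
     | Incremental => Num 0
     | Decremental =>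
         Bin Mul (Bin Eqb u (triple_plus 4)) (Bin Ltb v (triple_plus 4))
     end).

Lemma eval_code_expr st m c u v :
  eval st (code_expr m c u v) =
  code m (reg st 0) (arr st 0) (arr st 1) (eval st c) (eval st u) (eval st v).
Proof. destruct m; reflexivity. Qed.

Definition attached_expr (m : mode) (t : expr) : expr :=
  match m with
  | Incremental => Bin Add t (Num 1)
  | Decremental => Bin Sub (Var 0) t
  end.

Lemma eval_attached_expr st m t :
  eval st (attached_expr m t) = attached m (reg st 0) (eval st t).
Proof. destruct m; cbn; lia. Qed.

(* Array [base] is the simulated algorithm's array 0, its initial graph. *)
Definition fill (m : mode) : cmd :=
  for_loop 1 (Bin Mul (triple_plus 5) (triple_plus 5))
    (put base (Var 1)
      (code_expr m (attached_expr m (Num 0))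
        (Bin Div (Var 1) (triple_plus 5)) (Bin Mod (Var 1) (triple_plus 5)))).

Definition read_row : cmd :=
  for_loop 1 (Var 0)
    (put 2 (Bin Add (Bin Mul (Bin Sub (Var 3) (Num 1)) (Var 0)) (Var 1))
      (let x := Cell (base + 1) (Bin Add (double_plus 2) (Var 1)) in
       Bin Mul (Bin Ltb (Bin Mul (Bin Sub (Var 3) (Num 1)) (Var 0)) x)
         (Bin Sub (Bin Add (Bin Mul (Var 3) (Var 0)) (Num 1)) x))).

Definition target_expr (m : mode) : expr :=
  match m with
  | Incremental => Bin Add (Var 2) (Num 1)
  | Decremental => Bin Sub (Bin Sub (Var 0) (Var 2)) (Num 1)
  end.

Definition weight_expr (m : mode) : expr :=
  match m with
  | Incremental => Bin Add (Bin Mul (Var 0) (Var 0)) (Num 1)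
  | Decremental => Num 0
  end.

(** Register 3 keeps the number of attached rows for [read_row]. The simulated registers 4, 3, 2 are
    written in the order in which [feed] nests them. *)
Definition stage (m : mode) (P : dynamic_algorithm) : cmd :=
  Seq (set_var 3 (attached_expr m (Var 2)))
    (Seq read_row
      (Seq (set_var (base + 4) (weight_expr m))
        (Seq (set_var (base + 3) (target_expr m))
          (Seq (set_var (base + 2) (triple_plus 3))
            (shift base (react P)))))).

(** The test diverts [n = 0], where the schedule would contain a loop at the padding node. *)
Definition reduction (m : mode) (P : dynamic_algorithm) : cmd :=
  If 0
    (Seq (fill m)
      (Seq (set_var (base + 1) (triple_plus 3))
        (Seq (set_var (base + 0) (triple_plus 5))
          (Seq (shift base (setup P))
            (for_loop 2 (Var 0) (stage m P))))))
    Skip.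

Lemma list_sum_cons a l : list_sum (a :: l) = a + list_sum l.
Proof. reflexivity. Qed.

Lemma list_sum_const (c i k : nat) : list_sum (map (fun _ => c) (seq i k)) = k * c.
Proof.
  revert i. induction k as [|k IH]; intros i; [reflexivity|].
  cbn [seq map]. rewrite list_sum_cons, IH. lia.
Qed.

Lemma list_sum_add (f g : nat -> nat) l :
  list_sum (map (fun i => f i + g i) l) = list_sum (map f l) + list_sum (map g l).
Proof.
  induction l as [|a l IH]; [reflexivity|].
  cbn [map]. rewrite !list_sum_cons, IH. lia.
Qed.

Local Ltac small := apply Nat.leb_le; reflexivity.

Local Ltac within :=
  match goal with
  | H : ?k <= ?D |- _ <= ?D => apply (Nat.le_trans _ k); [small | exact H]
  end.

Lemma row_major_bit_le n f p : row_major n (fun i k => Nat.b2n (f i k)) p <= 1.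
Proof.
  unfold row_major. destruct (p <? n * n); [|lia].
  destruct (f _ _); cbn; lia.
Qed.

Lemma hosts_visible st s s' :
  hosts base st s -> same_visible s s' -> hosts base st s'.
Proof.
  intros [H1 H2] [H3 H4]. split; intros.
  - rewrite H3 by (right; lia). apply H1.
  - rewrite H4. apply H2.
Qed.

Lemma hosts_set_reg_below k st s x v :
  x < k -> hosts k st s -> hosts k st (set_reg x v s).
Proof.
  intros Hx [H1 H2]. split; [|exact H2]. intros y. cbn.
  rewrite upd_other by lia. apply H1.
Qed.

Lemma hosts_set_cell_below k st s a p v :
  a < k -> hosts k st s -> hosts k st (set_cell a p v s).
Proof.
  intros Ha [H1 H2]. split; [exact H1|]. intros a' p'. cbn.
  rewrite upd_other by lia. apply H2.
Qed.

(** The simulated registers and the arrays beyond [base] must still be 0, since [setup] expects a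
    blank memory apart from its input. *)
Definition filled (m : mode) (n : nat) (A B : nat -> nat -> bool) (p : nat)
    (st : state) : Prop :=
  reg st 0 = n /\ reg st 1 = p /\
  (forall q, arr st 0 q = row_major n (fun i k => Nat.b2n (A i k)) q) /\
  (forall q, arr st 1 q = row_major n (fun k j => Nat.b2n (B k j)) q) /\
  (forall x, base <= x -> reg st x = 0) /\
  (forall a q, base < a -> arr st a q = 0) /\
  (forall q, arr st base q =
    if q <? p then encode (net m n A B (attached m n 0)
      (q / (n + n + n + 5)) (q mod (n + n + n + 5))) else 0).

Lemma fill_runs m : exists K, forall w D n A B,
  fits w ((n + n + n + 5) * (n + n + n + 5)) D -> 300 <= D ->
  runs w (fill m) (mwp_input n A B) (K * ((n + n + n + 5) * (n + n + n + 5)))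
    (filled m n A B ((n + n + n + 5) * (n + n + n + 5))).
Proof.
  eexists. intros w D n A B HF HD.
  set (N := n + n + n + 5) in *.
  assert (HN : 5 <= N) by lia.
  eapply runs_mono.
  - eapply (runs_for w _ D) with (n := N * N) (I := filled m n A B);
      [exact HF | within | lia | small
      | unfold temp; lia | nia | lia | | |].
    + intros st1 [HR HA]. unfold filled. rewrite !HR by (unfold temp; lia).
      split; [reflexivity|]. split; [reflexivity|].
      split; [intros; now rewrite HA|]. split; [intros; now rewrite HA|].
      split; [|split].
      * intros x Hx. rewrite HR by auto. unfold base in Hx. cbn.
        rewrite !upd_other by lia. reflexivity.
      * intros a q Ha. rewrite HA. unfold base in Ha. cbn.
        rewrite !upd_other by lia. reflexivity.
      * intros q. now rewrite HA.
    + intros p st1 Hp (H0 & H1 & _). split; [exact H1|].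
      split; [cbn; now rewrite H0|].
      cbn. unfold temp. rewrite H0. repeat split; nia.
    + intros p st1 Hp (H0 & H1 & HA & HB & HR & HC & HE).
      eapply runs_mono.
      * apply (runs_put w _ D) with (1 := HF);
          [within | destruct m; within | small
          | destruct m; small | |].
        -- cbn. unfold temp. lia.
        -- assert (HA' : forall q, arr st1 0 q <= N * N).
           { intros q. rewrite HA. pose proof (row_major_bit_le n A q). nia. }
           assert (HB' : forall q, arr st1 1 q <= N * N).
           { intros q. rewrite HB. pose proof (row_major_bit_le n B q). nia. }
           assert (n <= N * N) by nia. assert (5 <= N * N) by nia.
           clear - H0 H1 HA' HB' H H2 Hp.
           destruct m; cbn [bounded code_expr attached_expr triple_plus double_plus arithmetic];
             repeat split; auto; try (unfold temp; lia).
      * apply Nat.le_refl.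
      * intros st2 [HR2 HA2].
        rewrite eval_code_expr, eval_attached_expr in HA2. cbn [eval] in HA2, HR2.
        assert (HV : code m (reg st1 0) (arr st1 0) (arr st1 1)
            (attached m (reg st1 0) 0) (p / N) (p mod N) =
          encode (net m n A B (attached m n 0) (p / N) (p mod N))).
        { rewrite encode_net, H0. unfold code. now rewrite HA, HB. }
        split; [rewrite HR2 by (unfold temp; lia); exact H1|].
        intros st3 [HR3 HA3]. unfold filled.
        split; [rewrite HR3 by (unfold temp; lia); cbn; rewrite HR2 by (unfold temp; lia); exact H0|].
        split; [rewrite HR3 by (unfold temp; lia); reflexivity|].
        assert (HA4 : forall a q, arr st3 a q =
          arr (set_cell base p (encode (net m n A B (attached m n 0) (p / N) (p mod N))) st1) a q).
        { intros a q. rewrite HA3. cbn [set_reg arr]. rewrite HA2.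
          cbn [eval_binop triple_plus eval]. rewrite H1, H0, <- HV, H0. reflexivity. }
        clear HA2 HA3.
        split; [intros; rewrite HA4; apply HA|]. split; [intros; rewrite HA4; apply HB|].
        split; [|split].
        -- intros x Hx. rewrite HR3 by auto. unfold base in Hx. cbn.
           rewrite upd_other by lia. rewrite HR2 by (right; exact Hx). now apply HR.
        -- intros a q Ha. rewrite HA4. cbn. rewrite upd_other by lia. now apply HC.
        -- intros q. rewrite HA4. cbn [set_cell arr]. rewrite upd_same. unfold upd.
           rewrite HE. destruct (Nat.eqb_spec q p) as [->|].
           ++ rewrite (proj2 (Nat.ltb_lt _ _)) by lia. reflexivity.
           ++ destruct (Nat.ltb_spec q p), (Nat.ltb_spec q (S p)); auto; lia.
  (* [K] is fixed here, from the cost [a] of the body and [b] of loop control; the second [b] comes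
     from [S (N * N) <= 2 * (N * N)]. *)
  - rewrite list_sum_const.
    match goal with |- N * N * ?a + S (N * N) * ?b <= _ =>
      instantiate (1 := a + b + b); generalize a, b end.
    intros a b. nia.
  - auto.
Qed.

Definition answer (n : nat) (A B : nat -> nat -> bool) (i j x : nat) : Prop :=
  exists o, is_least (witness n A B i j) o /\ x = encode o.

(** [out] is array 2 before the row is written, so that the rows of earlier stages are recovered
    after the loop. *)
Definition ready (n t c : nat) (sigma : state) (out : nat -> nat) (p : nat)
    (st : state) : Prop :=
  reg st 0 = n /\ reg st 1 = p /\ reg st 2 = t /\ reg st 3 = c /\
  hosts base sigma st /\
  (forall q, q < (c - 1) * n \/ (c - 1) * n + p <= q -> arr st 2 q = out q) /\
  (forall j, j < p -> arr st 2 ((c - 1) * n + j) =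
    decode n c (arr sigma 1 (n + n + 2 + j))).

Lemma read_row_runs : exists K, forall w D n t c sigma st,
  fits w ((n + n + n + 5) * (n + n + n + 5)) D -> 300 <= D ->
  c <= n ->
  (forall j, j < n -> arr sigma 1 (n + n + 2 + j) <= n * n) ->
  reg st 0 = n -> reg st 2 = t -> reg st 3 = c -> hosts base sigma st ->
  runs w read_row st (K * S n) (ready n t c sigma (arr st 2) n).
Proof.
  eexists. intros w D n t c sigma st HF HD Hc Hcell R0 R2 R3 Hh.
  set (N := n + n + n + 5) in *.
  assert (HN : n <= N * N) by nia. assert (HN2 : n * n <= N * N) by nia.
  assert (H5 : 5 <= N * N) by nia.
  eapply runs_mono.
  - eapply (runs_for w _ D) with (n := n) (I := ready n t c sigma (arr st 2));
      [exact HF | within | lia | small | unfold temp; lia | nia | lia | | |].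
    + intros st1 S1. unfold ready. pose proof S1 as [HR HA].
      rewrite !HR by (unfold temp; lia). cbn [set_reg reg]. rewrite upd_same.
      rewrite !upd_other by lia.
      do 4 (split; [auto|]). split; [|split].
      * eapply hosts_visible; [|exact S1].
        apply hosts_set_reg_below; [unfold base; lia | exact Hh].
      * intros q _. now rewrite HA.
      * lia.
    + intros p st1 Hp (H0 & H1 & H2 & H3 & _). split; [exact H1|].
      split; [exact H0|]. cbn. unfold temp. lia.
    + intros p st1 Hp (H0 & H1 & H2 & H3 & Hh1 & Hout & Hrow).
      assert (HX : arr st1 (base + 1) (n + n + 2 + p) = arr sigma 1 (n + n + 2 + p))
        by apply Hh1.
      eapply runs_mono.
      * apply (runs_put w _ D) with (1 := HF); [within | within | small | small | |].
        -- cbn. unfold temp. lia.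
        -- specialize (Hcell p Hp).
           cbn -[base Nat.mul]. rewrite H0, H1, HX. unfold temp.
           repeat split; lia.
      * apply Nat.le_refl.
      * intros st2 S2.
        assert (S2' : same_visible (set_cell 2 ((c - 1) * n + p)
          (decode n c (arr sigma 1 (n + n + 2 + p))) st1) st2).
        { cbn -[base Nat.mul] in S2. rewrite H0, H1, H3, HX in S2. exact S2. }
        clear S2. destruct S2' as [HR2 HA2].
        split; [rewrite HR2 by (unfold temp; lia); exact H1|].
        intros st3 S3. pose proof S3 as [HR3 HA3]. unfold ready.
        rewrite !HR3 by (unfold temp; lia). cbn [set_reg reg]. rewrite upd_same.
        rewrite !upd_other by lia. rewrite !HR2 by (unfold temp; lia).
        do 4 (split; [auto|]).
        assert (HA4 : forall q, arr st3 2 q =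
          upd (arr st1 2) ((c - 1) * n + p) (decode n c (arr sigma 1 (n + n + 2 + p))) q).
        { intros q. rewrite HA3. cbn [set_reg arr]. rewrite HA2. cbn [set_cell arr].
          now rewrite upd_same. }
        split; [|split].
        -- eapply hosts_visible; [|exact S3].
           apply hosts_set_reg_below; [unfold base; lia|].
           eapply hosts_visible; [|split; [exact HR2|exact HA2]].
           apply hosts_set_cell_below; [unfold base; lia | exact Hh1].
        -- intros q Hq. rewrite HA4, upd_other by lia. apply Hout. lia.
        -- intros j Hj. rewrite HA4. unfold upd.
           destruct (Nat.eqb_spec ((c - 1) * n + j) ((c - 1) * n + p)).
           ++ replace j with p by lia. reflexivity.
           ++ apply Hrow. lia.
  - rewrite list_sum_const.
    match goal with |- n * ?a + S n * ?b <= _ =>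
      instantiate (1 := a + b); generalize a, b end.
    intros a b. nia.
  - auto.
Qed.

Definition answered (m : mode) (n t i : nat) : Prop :=
  match m with Incremental => i < t | Decremental => n - t <= i end.

Definition progress (m : mode) (n : nat) (A B : nat -> nat -> bool)
    (sigma : nat -> state) (t : nat) (st : state) : Prop :=
  reg st 0 = n /\ reg st 2 = t /\ hosts base (sigma t) st /\
  (forall i j, answered m n t i -> i < n -> j < n ->
    answer n A B i j (arr st 2 (i * n + j))).

Lemma hosts_feed s tgt x sigma st st1 st2 st3 :
  hosts base sigma st ->
  same_visible (set_reg (base + 4) (encode x) st) st1 ->
  same_visible (set_reg (base + 3) tgt st1) st2 ->
  same_visible (set_reg (base + 2) s st2) st3 ->
  hosts base (feed (s, tgt, x) sigma) st3.
Proof.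
  intros H S1 S2 S3. cbn [feed].
  eapply hosts_visible; [|exact S3]. apply hosts_set_reg.
  eapply hosts_visible; [|exact S2]. apply hosts_set_reg.
  eapply hosts_visible; [|exact S1]. now apply hosts_set_reg.
Qed.

(** [K] precedes [P]: besides the [tau] steps of [react], a stage costs O(n) whatever algorithm is
    simulated. *)
Lemma stage_runs m : exists K, forall P w D n A B G sigma t tau st,
  fits w ((n + n + n + 5) * (n + n + n + 5)) D -> 300 <= D -> t < n ->
  (forall u v, G u v = net m n A B (attached m n t) u v) ->
  ssbp_output (n + n + n + 5) (n + n + n + 3) G (sigma t) ->
  exec w (react P) (feed (stage_update m n t) (sigma t)) (sigma (S t)) tau ->
  progress m n A B sigma t st ->
  runs w (stage m P) st (tau + K * S n) (fun st2 => reg st2 2 = t /\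
    forall st3, same_visible (set_reg 2 (S t) st2) st3 ->
      progress m n A B sigma (S t) st3).
Proof.
  destruct read_row_runs as [K0 HK0]. eexists.
  intros P w D n A B G sigma t tau st HF HD Ht HG Hout Hex (R0 & R2 & Hh & Hans).
  set (N := n + n + n + 5) in *.
  assert (HN : n <= N * N) by nia. assert (HN2 : n * n <= N * N) by nia.
  assert (H5 : 5 <= N * N) by nia.
  set (c := attached m n t) in *.
  assert (Hc : exists i, c = S i /\ i < n).
  { unfold c. destruct m; cbn [attached]; [exists t | exists (n - t - 1)]; lia. }
  destruct Hc as (i & Hci & Hi). rewrite Hci in HG.
  assert (Hval : forall j, j < n -> arr (sigma t) 1 (n + n + 2 + j) <= n * n /\
    answer n A B i j (decode n (S i) (arr (sigma t) 1 (n + n + 2 + j)))).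
  { intros j Hj. destruct (Hout (n + n + 2 + j)) as (o & Ho & ->); [lia|lia|].
    destruct (decode_bottleneck m n A B i G j o HG Hi Hj Ho) as (H1 & o' & H2 & H3).
    split; [auto|]. exists o'. auto. }
  eapply runs_le.
  - eapply runs_seq. eapply runs_mono;
      [apply (runs_set_var w _ D) with (1 := HF);
        [destruct m; within | destruct m; small | ] | apply Nat.le_refl | ].
    { destruct m; cbn; unfold temp; lia. }
    intros st1 S1.
    rewrite eval_attached_expr in S1. cbn [eval] in S1. rewrite R0, R2 in S1.
    fold c in S1. pose proof S1 as [HR1 HA1].
    eapply runs_seq. eapply runs_mono;
      [apply (HK0 w D n t c (sigma t)); [exact HF | exact HD | lia | | | | |]
      | apply Nat.le_refl | ].
    { intros j Hj. now apply Hval. }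
    { rewrite HR1 by (unfold temp; lia). exact R0. }
    { rewrite HR1 by (unfold temp; lia). exact R2. }
    { rewrite HR1 by (unfold temp; lia). reflexivity. }
    { eapply hosts_visible; [|exact S1].
      apply hosts_set_reg_below; [unfold base; lia | exact Hh]. }
    intros st2 (Q0 & _ & Q2 & _ & Hh2 & Hold & Hnew).
    eapply runs_seq. eapply runs_mono;
      [apply (runs_set_var w _ D) with (1 := HF);
        [destruct m; within | destruct m; small | ] | apply Nat.le_refl | ].
    { destruct m; cbn; unfold temp; lia. }
    intros st3 S3. pose proof S3 as [HR3 HA3].
    eapply runs_seq. eapply runs_mono;
      [apply (runs_set_var w _ D) with (1 := HF);
        [destruct m; within | destruct m; small | ] | apply Nat.le_refl | ].
    { destruct m; cbn; rewrite ?HR3 by (unfold temp; lia); cbn; unfold temp; lia. }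
    intros st4 S4. pose proof S4 as [HR4 HA4].
    eapply runs_seq. eapply runs_mono;
      [apply (runs_set_var w _ D) with (1 := HF); [within | small | ]
      | apply Nat.le_refl | ].
    { cbn; rewrite HR4 by (unfold temp; lia); cbn.
      rewrite HR3 by (unfold temp; lia); cbn; unfold temp; lia. }
    intros st5 S5. pose proof S5 as [HR5 HA5].
    assert (Hlow : forall x, x < temp -> reg st5 x = reg st2 x).
    { intros x Hx. unfold temp in Hx.
      rewrite HR5 by (unfold temp; lia). cbn. rewrite upd_other by lia.
      rewrite HR4 by (unfold temp; lia). cbn. rewrite upd_other by lia.
      rewrite HR3 by (unfold temp; lia). cbn. now rewrite upd_other by lia. }
    assert (Q30 : reg st3 0 = n) by (rewrite HR3 by (unfold temp; lia); exact Q0).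
    assert (Q32 : reg st3 2 = t) by (rewrite HR3 by (unfold temp; lia); exact Q2).
    assert (Q40 : reg st4 0 = n) by (rewrite HR4 by (unfold temp; lia); exact Q30).
    assert (Hfeed : hosts base (feed (stage_update m n t) (sigma t)) st5).
    { cbn [eval eval_binop triple_plus] in S5. rewrite Q40 in S5.
      destruct m; cbn [stage_update]; (eapply hosts_feed; [exact Hh2 | | | exact S5]).
      - cbn [weight_expr eval eval_binop] in S3. rewrite Q0, Nat.add_1_r in S3. exact S3.
      - cbn [target_expr eval eval_binop] in S4. rewrite Q32, Nat.add_1_r in S4. exact S4.
      - exact S3.
      - cbn [target_expr eval eval_binop] in S4. rewrite Q30, Q32 in S4. exact S4. }
    eapply runs_mono; [eapply runs_shift; [exact Hex | exact Hfeed] | apply Nat.le_refl | ].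
    intros st6 [Hh6 [L6 LA6]].
    split.
    { rewrite L6 by (unfold base; lia). rewrite Hlow by (unfold temp; lia). exact Q2. }
    intros st7 S7. pose proof S7 as [HR7 HA7]. unfold progress.
    split; [|split; [|split]].
    + rewrite HR7 by (unfold temp; lia). cbn.
      rewrite L6 by (unfold base; lia). rewrite Hlow by (unfold temp; lia). exact Q0.
    + rewrite HR7 by (unfold temp; lia). reflexivity.
    + eapply hosts_visible; [|exact S7].
      apply hosts_set_reg_below; [unfold base; lia | exact Hh6].
    + intros i' j Hi' Hi'n Hj.
      assert (HA : forall q, arr st7 2 q = arr st2 2 q).
      { intros q. rewrite HA7. cbn [set_reg arr]. rewrite LA6 by (unfold base; lia).
        rewrite HA5. cbn [set_reg arr]. rewrite HA4. cbn [set_reg arr]. apply HA3. }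
      rewrite HA. rewrite Hci in Hold, Hnew. replace (S i - 1) with i in * by lia.
      destruct (Nat.eq_dec i' i) as [->|Hne].
      * rewrite Hnew by auto. now apply Hval.
      * rewrite Hold by nia. rewrite HA1. cbn [set_reg arr].
        apply Hans; auto.
        unfold c in Hci. destruct m; cbn in *; lia.
  - match goal with |- ?a + (K0 * S n + (?b + (?c0 + (?d + tau)))) <= _ =>
      instantiate (1 := a + K0 + b + c0 + d); generalize a, b, c0, d end.
    intros a b c0 d. nia.
Qed.

(** With [l = S (Nat.log2 n)] one has [3 n + 5 <= 2^(3 l)], so the base is at most [2^(6 l)] and its
    power at most [2^(6 l D)]; the remaining [l] bits make the inequality strict. *)
Lemma fits_word_length D n :
  fits (word_length (6 * D + 1) n) ((n + n + n + 5) * (n + n + n + 5)) D.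
Proof.
  unfold fits, word_length. split; [nia|].
  set (l := S (Nat.log2 n)).
  assert (Hn : n < 2 ^ l).
  { unfold l. destruct n as [|n']; [cbn; lia | apply Nat.log2_spec; lia]. }
  assert (Hl : 2 <= 2 ^ l).
  { change 2 with (2 ^ 1) at 1. apply Nat.pow_le_mono_r; unfold l; lia. }
  assert (HN : n + n + n + 5 <= 2 ^ (3 * l)).
  { replace (3 * l) with (l + (l + l)) by lia. rewrite !Nat.pow_add_r.
    assert (4 <= 2 ^ l * 2 ^ l) by nia. nia. }
  apply (Nat.le_lt_trans _ (2 ^ (6 * l * D))).
  - rewrite Nat.pow_mul_r. apply Nat.pow_le_mono_l.
    replace (6 * l) with (3 * l + 3 * l) by lia. rewrite Nat.pow_add_r.
    now apply Nat.mul_le_mono.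
  - apply Nat.pow_lt_mono_r; [lia|]. unfold l. nia.
Qed.

Lemma word_length_le c n : word_length c (n + n + n + 5) <= word_length (4 * c) n.
Proof.
  unfold word_length.
  assert (S (Nat.log2 (n + n + n + 5)) <= 4 * S (Nat.log2 n)); [|nia].
  set (l := S (Nat.log2 n)).
  assert (Hn : n < 2 ^ l).
  { unfold l. destruct n as [|n']; [cbn; lia | apply Nat.log2_spec; lia]. }
  assert (Hl : 2 <= 2 ^ l).
  { change 2 with (2 ^ 1) at 1. apply Nat.pow_le_mono_r; unfold l; lia. }
  assert (HN : n + n + n + 5 < 2 ^ (4 * l)).
  { replace (4 * l) with ((l + l) + (l + l)) by lia. rewrite !Nat.pow_add_r.
    assert (4 <= 2 ^ l * 2 ^ l) by nia. nia. }
  apply Nat.log2_lt_pow2 in HN; lia.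
Qed.

Lemma runs_reduction m P T : computes_ssbp m 2 P T ->
  exists K, computes_mwp (reduction m P)
    (fun n => T (n + n + n + 5) + K * ((n + n + n + 5) * (n + n + n + 5))).
Proof.
  intros (c0 & HP).
  destruct (fill_runs m) as [K1 HK1], (stage_runs m) as [K2 HK2].
  eexists. exists (4 * c0 + (6 * 300 + 1)). intros n A B.
  set (w := word_length (4 * c0 + (6 * 300 + 1)) n).
  set (N := n + n + n + 5).
  destruct (Nat.eq_dec n 0) as [Hn|Hn].
  { exists (mwp_input n A B), 2. split; [|split].
    - apply exec_if_false; [exact Hn | constructor].
    - intros i j Hi. lia.
    (* The unknown constant is refined to [2 + _], which pays for the two steps of the empty case;
       the rest is chosen at the end. *)
    - match goal with |- _ <= _ + ?k * _ => instantiate (1 := 2 + _) end. nia. }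
  destruct (HP N (n + n + n + 3) (net m n A B (attached m n 0)) (schedule m n))
    as (st0 & t0 & ts & Hsetup & Hserves & HT).
  { unfold N. lia. }
  { apply net_is_graph. destruct m; cbn; lia. }
  { apply schedule_length. }
  { apply schedule_legal. lia. }
  assert (Hw1 : word_length c0 N <= w).
  { eapply Nat.le_trans; [apply word_length_le|]. unfold w, word_length. nia. }
  assert (HF : fits w (N * N) 300).
  { destruct (fits_word_length 300 n) as [HM HL]. split; [exact HM|].
    eapply Nat.lt_le_trans; [exact HL|].
    apply Nat.pow_le_mono_r; [lia|]. unfold w, word_length. nia. }
  destruct (serves_trace _ _ _ _ (stage_update m n 0) _ _ _ _ Hserves)
    as (G & sigma & tau & HG0 & Hs0 & Hstep & Hout & Hsum).
  rewrite schedule_length in Hstep, Hout, Hsum. fold N in Hstep, Hout, Hsum.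
  assert (HGt : forall t, t <= n ->
    forall u v, G t u v = net m n A B (attached m n t) u v).
  { induction t as [|t IH]; intros Ht.
    - intros u v. now rewrite HG0.
    - destruct (Hstep t) as [HGS _]; [unfold N; lia|].
      rewrite schedule_nth in HGS by lia. rewrite HGS.
      apply apply_stage_update; [lia|]. apply IH. lia. }
  assert (Hsum' : list_sum (map tau (seq 0 n)) <= ts).
  { rewrite <- Hsum. replace N with (n + (n + n + 5)) by (unfold N; lia).
    rewrite seq_app, map_app, list_sum_app. lia. }
  assert (HN : n <= N * N) by (unfold N; nia).
  assert (H5 : 5 <= N * N) by (unfold N; nia).
  assert (Hrun : runs w (reduction m P) (mwp_input n A B)
    (S (K1 * (N * N) + (20 + (20 + (t0 +
       (list_sum (map (fun t => tau t + K2 * S n) (seq 0 n)) + S n * 9))))))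
    (progress m n A B sigma n)).
  { enough (HQ : runs w (Seq (fill m)
      (Seq (set_var (base + 1) (triple_plus 3))
        (Seq (set_var (base + 0) (triple_plus 5))
          (Seq (shift base (setup P))
            (for_loop 2 (Var 0) (stage m P)))))) (mwp_input n A B)
      (K1 * (N * N) + (20 + (20 + (t0 +
       (list_sum (map (fun t => tau t + K2 * S n) (seq 0 n)) + S n * 9)))))
      (progress m n A B sigma n)).
    { destruct HQ as (st' & t' & E & Ht' & HQ). exists st', (S t').
      split; [now apply exec_if_true|]. split; [lia|auto]. }
    apply runs_seq. eapply runs_mono; [apply (HK1 w 300); [exact HF|lia] | apply Nat.le_refl |].
    fold N. intros st1 (R0 & _ & HA0 & HA1 & HR & HC & HE).
    apply runs_seq. eapply runs_mono;
      [apply (runs_set_var w _ 300) with (1 := HF); [small | small |] | cbn; lia |].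
    { cbn. unfold temp. lia. }
    intros st2 S2. pose proof S2 as [HR2 HA2]. cbn [eval eval_binop triple_plus] in S2.
    rewrite R0 in S2.
    assert (R02 : reg st2 0 = n) by (rewrite HR2 by (unfold temp; lia); exact R0).
    apply runs_seq. eapply runs_mono;
      [apply (runs_set_var w _ 300) with (1 := HF); [small | small |] | cbn; lia |].
    { cbn. unfold temp. lia. }
    intros st3 S3. pose proof S3 as [HR3 HA3]. cbn [eval eval_binop triple_plus] in S3.
    rewrite R02 in S3.
    assert (R03 : reg st3 0 = n) by (rewrite HR3 by (unfold temp; lia); exact R02).
    assert (Hin : hosts base (ssbp_input N (n + n + n + 3) (net m n A B (attached m n 0))) st3).
    { unfold ssbp_input.
      eapply hosts_visible; [|exact S3]. apply hosts_set_reg.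
      eapply hosts_visible; [|exact S2]. apply hosts_set_reg.
      split; [intros x; apply HR; lia|]. intros a q. cbn. unfold upd.
      destruct (Nat.eqb_spec a 0) as [->|Ha].
      - apply HE.
      - apply HC. unfold base. lia. }
    apply runs_seq. eapply runs_mono;
      [eapply runs_shift; [|exact Hin] | apply Nat.le_refl |].
    { eapply exec_word_mono; [exact Hw1 | exact Hsetup]. }
    intros st4 [Hh4 [L4 LA4]].
    eapply runs_mono.
    - eapply (runs_for w _ 300) with (n := n) (I := progress m n A B sigma)
        (tb := fun t => tau t + K2 * S n);
        [exact HF | small | lia | small | unfold temp; lia | lia | lia | | |].
      + intros st5 S5. pose proof S5 as [HR5 HA5]. split; [|split; [|split]].
        * rewrite HR5 by (unfold temp; lia). cbn.
          rewrite L4 by (unfold base; lia). exact R03.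
        * rewrite HR5 by (unfold temp; lia). reflexivity.
        * rewrite Hs0. eapply hosts_visible; [|exact S5].
          apply hosts_set_reg_below; [unfold base; lia | exact Hh4].
        * intros i j Hi. destruct m; cbn in Hi; lia.
      + intros t st5 Ht (Q0 & Q2 & _). split; [exact Q2|]. split; [exact Q0|].
        cbn. unfold temp. lia.
      + intros t st5 Ht Hprog.
        destruct (Hstep t) as [_ Hex]; [unfold N; lia|].
        rewrite schedule_nth in Hex by lia.
        apply (HK2 P w 300 n A B (G t) sigma t (tau t) st5); auto.
        * apply HGt. lia.
        * apply Hout. unfold N. lia.
        * eapply exec_word_mono; [exact Hw1 | exact Hex].
    - apply Nat.le_refl.
    - auto. }
  destruct Hrun as (st' & t' & E & Ht' & HQ & _ & _ & Hans).
  exists st', t'. split; [exact E|]. split.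
  - intros i j Hi Hj. destruct (Hans i j) as (o & Ho & Ho'); auto.
    { destruct m; cbn; lia. }
    exists o. auto.
  - eapply Nat.le_trans; [exact Ht'|].
    rewrite list_sum_add, list_sum_const.
    instantiate (1 := K1 + K2 + 60).
    unfold N in *. nia.
Qed.

(** * Exponents *)

Lemma Rpower_le_exponent n a b : 1 <= n -> (a <= b)%R ->
  (Rpower (INR n) a <= Rpower (INR n) b)%R.
Proof.
  intros Hn Hab. apply le_INR in Hn. cbn in Hn.
  destruct (Req_dec (INR n) 1) as [->|H1].
  - unfold Rpower. rewrite ln_1, !Rmult_0_r. lra.
  - apply Rle_Rpower; lra.
Qed.

Lemma mwp_time_of_ssbp m P f eps : (0 < eps <= 1 / 2)%R ->
  (forall n, 1 <= n -> (f n <= Rpower (INR n) (5 / 2 - eps))%R) ->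
  (forall n, (0 <= f n)%R) ->
  ssbp_total_time m P f ->
  mwp_time (reduction m P) (fun n => Rpower (INR n) (5 / 2 - eps)).
Proof.
  (* Degree 2 suffices, as all weights are at most [n * n <= N ^ 2]. *)
  intros Heps Hf Hf0 HP. destruct (HP 2) as (T & HT & C & N0 & Hbound).
  destruct (runs_reduction m P T HT) as [K HK].
  eexists. split; [exact HK|].
  set (a := (5 / 2 - eps)%R) in *.
  (* The 8 comes from [3 n + 5 <= 8 n] for [n >= 1]; [Rabs C] is taken because [bigO] allows a
     negative constant. *)
  exists ((Rabs C + INR K) * Rpower 8 a)%R, (Nat.max N0 1). intros n Hn.
  set (N := n + n + n + 5).
  rewrite Rabs_pos_eq by apply pos_INR.
  rewrite plus_INR, !mult_INR.
  assert (Hn1 : (1 <= INR n)%R) by (apply (le_INR 1); lia).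
  assert (HN1 : (1 <= INR N)%R) by (apply (le_INR 1); unfold N; lia).
  assert (H1 : (INR (T N) <= Rabs C * Rpower (INR N) a)%R).
  { eapply Rle_trans; [apply Rle_abs|].
    eapply Rle_trans; [apply Hbound; unfold N; lia|].
    eapply Rle_trans; [apply Rmult_le_compat_r; [apply Hf0 | apply Rle_abs]|].
    apply Rmult_le_compat_l; [apply Rabs_pos|]. apply Hf. unfold N. lia. }
  assert (H2 : (INR N * INR N <= Rpower (INR N) a)%R).
  { replace (INR N * INR N)%R with (Rpower (INR N) 2).
    - apply Rpower_le_exponent; [unfold N; lia|]. unfold a. lra.
    - change 2%R with (INR 2). rewrite Rpower_pow by lra. cbn. ring. }
  assert (H3 : (Rpower (INR N) a <= Rpower 8 a * Rpower (INR n) a)%R).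
  { rewrite Rpower_mult_distr by lra.
    apply Rle_Rpower_l; [unfold a; lra|]. split; [lra|].
    unfold N. rewrite !plus_INR. cbn [INR]. lra. }
  pose proof (pos_INR K). pose proof (Rabs_pos C).
  apply (Rle_trans _ ((Rabs C + INR K) * Rpower (INR N) a)).
  - rewrite Rmult_plus_distr_r. apply Rplus_le_compat; [exact H1|].
    now apply Rmult_le_compat_l.
  - rewrite Rmult_assoc. apply Rmult_le_compat_l; [lra | exact H3].
Qed.

(** The same constant works in both directions; the threshold is raised to 1 so that the division by
    [INR n] is meaningful. *)
Lemma bigO_amortized (T : nat -> nat) a :
  bigO (fun n => INR (T n)) (fun n => Rpower (INR n) (a + 1)) <->
  bigO (fun n => (INR (T n) / INR n)%R) (fun n => Rpower (INR n) a).
Proof.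
  assert (Hpow : forall n, 1 <= n -> (0 < INR n)%R /\
    Rpower (INR n) (a + 1) = (Rpower (INR n) a * INR n)%R).
  { intros n Hn. assert (H : (0 < INR n)%R) by (apply lt_0_INR; lia).
    split; [exact H|]. rewrite Rpower_plus, Rpower_1 by exact H. reflexivity. }
  split; intros (C & N0 & H); exists C, (Nat.max N0 1); intros n Hn;
    specialize (H n ltac:(lia)); destruct (Hpow n ltac:(lia)) as [Hn0 Ep].
  - rewrite Ep in H. unfold Rdiv.
    rewrite Rabs_mult, (Rabs_pos_eq (/ INR n))
      by (left; apply Rinv_0_lt_compat; exact Hn0).
    apply (Rmult_le_reg_r (INR n)); [exact Hn0|].
    rewrite Rmult_assoc, Rinv_l by lra. lra.
  - rewrite Ep. unfold Rdiv in H.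
    rewrite Rabs_mult, (Rabs_pos_eq (/ INR n)) in H
      by (left; apply Rinv_0_lt_compat; exact Hn0).
    apply (Rmult_le_compat_r (INR n)) in H; [|lra].
    rewrite Rmult_assoc, Rinv_l in H by lra. lra.
Qed.

Lemma ssbp_total_amortized m P a :
  ssbp_total_time m P (fun n => Rpower (INR n) (a + 1)) <->
  ssbp_amortized_time m P (fun n => Rpower (INR n) a).
Proof.
  split; intros H d; destruct (H d) as (T & HT & HO); exists T;
    (split; [exact HT | now apply bigO_amortized]).
Qed.

Lemma ssbp_total_requires m :
  mwp_hypothesis -> requires_exponent (ssbp_total_time m) (5 / 2)%R.
Proof.
  intros Hyp P eps Heps HP.
  (* The n^2 cost of writing down the graph is dominated only if eps <= 1/2. *)
  apply (Hyp (Rmin eps (1 / 2))); [apply Rmin_pos; lra|].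
  exists (reduction m P).
  eapply mwp_time_of_ssbp; [| | |exact HP].
  - split; [apply Rmin_pos; lra | apply Rmin_r].
  - intros n Hn. apply Rpower_le_exponent; [exact Hn|].
    pose proof (Rmin_l eps (1 / 2)). lra.
  - intros n. left. apply exp_pos.
Qed.

Theorem theorem4p16 :
  mwp_hypothesis ->
  forall m : mode,
    requires_exponent (ssbp_total_time m) (5 / 2)%R /\
    requires_exponent (ssbp_amortized_time m) (3 / 2)%R /\
    (forall (P : dynamic_algorithm) (eps : R), (0 < eps)%R ->
       ssbp_total_time m P (fun n => Rpower (INR n) (5 / 2 - eps)) <->
       ssbp_amortized_time m P (fun n => Rpower (INR n) (3 / 2 - eps))).
Proof.
  intros Hyp m.
  assert (Heq : forall P eps,
    ssbp_total_time m P (fun n => Rpower (INR n) (5 / 2 - eps)) <->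
    ssbp_amortized_time m P (fun n => Rpower (INR n) (3 / 2 - eps))).
  { intros P eps. replace (5 / 2 - eps)%R with (3 / 2 - eps + 1)%R by lra.
    apply ssbp_total_amortized. }
  pose proof (ssbp_total_requires m Hyp) as Htot.
  split; [exact Htot|]. split; [|auto].
  intros P eps Heps HP. apply (Htot P eps Heps). now apply Heq.
Qed.
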